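(* Let $z\in\mathbb{C}\setminus\{0\}$ and $0\le x<1$. If $s_0\in\mathbb{C}$, with $\sigma_0=\Re(s_0)$, is a pole of the (meromorphically continued) Lerch-type zeta function $s\mapsto\varphi(z,s,x)$, then the residue of $\varphi(z,s,x)$ at $s_0$ is a polynomial in the variable $x$ and, in fact, if $$j_0=\left[-\sigma_0+\frac{\log|z|}{\log\alpha_1}\right],$$ we have $$\operatorname{res}_{s=s_0}\varphi(z,s,x)=\sum_{j=0}^{j_0}\binom{-s_0}{j}\left(\operatorname{res}_{s=s_0}\varphi(z,s+j,0)\right)x^j .$$
   Context: Setting: $\{a_n\}_{n\ge 1}$ is a linear recurrence sequence over $\mathbb{Z}$, i.e. a sequence of integers for which there is a monic $Q\in\mathbb{Z}[X]$ with $Q(\nabla)a_n=0$ for all $n$, where $\nabla a_n=a_{n+1}$. Its minimal polynomial $P\in\mathbb{Z}[X]$ (the monic polynomial of least degree with $P(\nabla)$ annihilating $\{a_n\}$) is assumed irreducible over $\mathbb{Q}$, of degree $r$, with (simple) roots $\alpha_1,\dots,\alpha_r\in\mathbb{C}$, and $\alpha_1$ is a dominant root: $\alpha_1$ is real, $\alpha_1>1$ and $\alpha_1>|\alpha_i|$ for $i=2,\dots,r$. The sequence $\{a_n\}$ is assumed to be a strictly increasing sequence of positive integers. For $0\le x<1$ and fixed $z\neq 0$, $\varphi(z,s,x)$ denotes the meromorphic continuation to the whole $s$-plane of the Dirichlet series $\sum_{n=1}^{\infty}z^n(a_n+x)^{-s}$, which converges absolutely for $\Re(s)>\frac{\log|z|}{\log\alpha_1}$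 (powers defined through the real logarithm). $[\,\cdot\,]$ denotes the integer part (floor). For $j\ge0$, $\binom{-s}{j}=\frac{(-s)(-s-1)\cdots(-s-j+1)}{j!}$, and $x^0=1$. A residue at a point of holomorphy is $0$. *)

(* Defs.v *)
From HB Require Import structures.
From mathcomp Require Import all_boot all_order all_algebra.
From mathcomp Require Import all_classical all_reals all_analysis.
From mathcomp Require Import complex.

Set Implicit Arguments.
Unset Strict Implicit.
Unset Printing Implicit Defensive.

Import Order.TTheory GRing.Theory Num.Theory.
Import numFieldNormedType.Exports.
Import Normc.

Local Open Scope classical_set_scope.
Local Open Scope ring_scope.
Local Open Scope complex_scope.

(** The sequence [a_n], [n >= 1], is represented by [a : nat -> int]; the value
    [a 0] is never used. *)

(* [Q(nabla) a_n = 0] for all [n >= 1], where [nabla a_n = a_(n+1)] *)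
Definition annihilates (Q : {poly int}) (a : nat -> int) : Prop :=
  forall n : nat, (1 <= n)%N -> \sum_(i < size Q) Q`_i * a (n + i)%N = 0.

Definition linear_recurrence (a : nat -> int) : Prop :=
  exists2 Q : {poly int}, Q \is monic & annihilates Q a.

Definition minimal_polynomial (a : nat -> int) (P : {poly int}) : Prop :=
  [/\ P \is monic, annihilates P a &
      forall Q : {poly int}, Q \is monic -> annihilates Q a ->
        (size P <= size Q)%N].

Section Laurent.
Variable K : numFieldType.

Definition sums_to (u : nat -> K) (l : K) : Prop := series u @ \oo --> l.

(* [c] is the family of coefficients of a Laurent series about [s0], with
   finite principal part, that converges to [f] on a punctured neighbourhood
   of [s0]; the value of [f] at [s0] itself plays no role. *)
Definition laurent_expansion (f : K -> K) (s0 : K) (c : int -> K) : Prop :=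
  exists2 N : nat,
    forall k : int, k < - N%:Z -> c k = 0 &
    \forall s \near s0^',
      sums_to (fun n : nat => c (n%:Z - N%:Z) * (s - s0) ^ (n%:Z - N%:Z)) (f s).

Definition meromorphic (f : K -> K) : Prop :=
  forall s0 : K, exists c : int -> K, laurent_expansion f s0 c.

Definition is_pole (f : K -> K) (s0 : K) : Prop :=
  exists2 c : int -> K, laurent_expansion f s0 c &
    exists2 k : int, k < 0 & c k != 0.

(* The Laurent coefficient of index [-1], which is unique when it exists;
   [0] if [f] has no Laurent expansion at [s0]. *)
Definition residue (f : K -> K) (s0 : K) : K :=
  xget 0 [set v : K | exists2 c : int -> K, laurent_expansion f s0 c &
                        c (- 1) = v].

End Laurent.

Section Complex.
Variable R : realType.
Local Notation C := R[i].

(* [alpha1] is a real root of [P], [alpha1 > 1], and [alpha1] exceeds the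
   modulus of every other complex root of [P].  Roots are quantified over as a
   set: an irreducible [P] has no multiple root. *)
Definition dominant_root (P : {poly int}) (alpha1 : R) : Prop :=
  [/\ root (map_poly intr P : {poly C}) alpha1%:C, 1 < alpha1 &
      forall b : C, root (map_poly intr P) b -> b != alpha1%:C ->
        normc b < alpha1].

(* [t ^ w := exp (w * ln t)] for a real [t > 0], with [exp] expanded by Euler's
   formula. *)
Definition cpow (t : R) (w : C) : C :=
  (expR (complex.Re w * ln t))%:C *
  (cos (complex.Im w * ln t) +i* sin (complex.Im w * ln t)).

(* [F] is the meromorphic continuation to the whole plane of
   [sum_(n >= 1) z ^ n * (a_n + x) ^ (- s)], as given on the half-plane
   [Re s > ln |z| / ln alpha1]. *)
Definition lerch_continuation (a : nat -> int) (alpha1 : R) (z : C) (x : R)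
    (F : C -> C) : Prop :=
  meromorphic F /\
  forall s : C, ln (normc z) / ln alpha1 < complex.Re s ->
    sums_to (fun n : nat => z ^+ n.+1 * cpow ((a n.+1)%:~R + x) (- s)) (F s).

Definition cbinom (w : C) (j : nat) : C :=
  (\prod_(i < j) (w - i%:R)) / (j`!)%:R.

End Complex.

(* Main.v *)
Require Import Defs.
From HB Require Import structures.
From mathcomp Require Import all_boot all_order all_algebra.
From mathcomp Require Import all_classical all_reals all_analysis.
From mathcomp Require Import separable complex ring lra.

Set Implicit Arguments.
Unset Strict Implicit.
Unset Printing Implicit Defensive.

Import Order.TTheory GRing.Theory Num.Theory.
Import numFieldNormedType.Exports.
Import Normc.

Local Open Scope classical_set_scope.
Local Open Scope ring_scope.
Local Open Scope complex_scope.

Local Arguments normc {R} x : simpl never.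

(** Write [L = log |z| / log alpha1].  The formula is a binomial expansion in
    [x], and the only obstacle to taking its residue term by term is the
    possible presence of multiple poles.

    From [(a_n + x) ^ (-s) = a_n ^ (-s) (1 + x / a_n) ^ (-s)] and the binomial
    series truncated at order [K] one gets, for [Re s > L],
      [phi(s, x) = sum_(j < K) binom(-s, j) x ^ j phi(s + j, 0) + H(s)].
    The terms of [H] are of size [|z| ^ n a_n ^ (- Re s - K)] and [a_n] grows
    like [alpha1 ^ n], so [H] is analytic for [Re s > L - K]
    ([analytic_remainder_series]).  Both sides being meromorphic, the identity
    persists there ([identity_on_ray]), and by definition of the floor [s0]
    lies in this half-plane for [K = j0 + 1], or for [K = 0] when [j0 < 0].

    The residue of [binom(-s, j) phi(s + j, 0)] at [s0] is [binom(-s0, j)]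
    times that of [phi(s + j, 0)] because all poles of [phi(s, 0)] are simple
    ([lerch_simple_poles]).  Irreducibility of [P] makes its roots simple and
    forces the dominant root to occur in [a_n], with a positive coefficient as
    [a_n > 0]; so [a_n = c alpha1 ^ n (1 + e_n)] where [e_n] is a combination
    of [n]-th powers of numbers of modulus less than 1 ([dominant_form]).  The same
    truncated binomial expansion, now in [e_n], leaves geometric series: it
    expresses [phi(s, 0)] through finitely many functions
    [binom(-s, k) d c ^ (-s) / (1 - w alpha1 ^ (-s))], whose poles are simple,
    up to a remainder that is analytic as far to the left as desired.

    The function theory rests on power series alone.  An analytic function
    carries a bound on [sum_k |c_k| r ^ k] ([expands]); these norms are
    submultiplicative, which yields products, inverses and dominated sums
    ([expandsM], [analyticV], [expands_series]) with elementary estimates, and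
    continuation along a horizontal ray only uses that the zero of a nonzero
    power series at its centre is isolated. *)

(** * The modulus of a complex number *)

Section Modulus.
Variable R : realType.
Local Notation C := R[i].
Implicit Types x y : C.

Lemma normc_ge0 x : 0 <= normc x.
Proof. by case: x => a b; exact: sqrtr_ge0. Qed.

Lemma normr_normc x : `|x| = (normc x)%:C.
Proof. by case: x => a b; rewrite normc_def. Qed.

Lemma normcD x y : normc (x + y) <= normc x + normc y.
Proof. exact: le_normcD. Qed.

Lemma normc_opp x : normc (- x) = normc x.
Proof. exact: normcN. Qed.

Lemma normcB x y : normc (x - y) = normc (y - x).
Proof. by rewrite -normc_opp opprB. Qed.

Lemma normcBD x y z : normc (x - z) <= normc (x - y) + normc (y - z).
Proof. by rewrite -(subrK y x) -addrA (le_trans (normcD _ _))// subrK. Qed.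

Lemma normc_eq0 x : (normc x == 0) = (x == 0).
Proof. by apply/eqP/eqP => [/eq0_normc|->]; [|exact: normc0]. Qed.

Lemma normc_gt0 x : (0 < normc x) = (x != 0).
Proof.
by rewrite lt_neqAle normc_ge0 andbT eq_sym -normc_eq0.
Qed.

Lemma normcX x n : normc (x ^+ n) = normc x ^+ n.
Proof.
by elim: n => [|n IH]; rewrite ?expr0 ?normc1// !exprS normcM IH.
Qed.

Lemma normc_real (t : R) : normc t%:C = `|t|.
Proof. by rewrite /normc /= expr0n /= addr0 sqrtr_sqr. Qed.

Lemma normc_nat n : normc (n%:R : C) = n%:R.
Proof.
have -> : (n%:R : C) = (n%:R : R)%:C by rewrite rmorph_nat.
by rewrite normc_real ger0_norm.
Qed.

Lemma normc_sum (I : Type) (r : seq I) (P : pred I) (F : I -> C) :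
  normc (\sum_(i <- r | P i) F i) <= \sum_(i <- r | P i) normc (F i).
Proof.
elim/big_rec2: _ => [|i u v _ uv]; first by rewrite normc0.
by rewrite (le_trans (normcD _ _))// lerD2l.
Qed.

Lemma normc_Re x : `|complex.Re x| <= normc x.
Proof. by rewrite -lecR -normr_normc; exact: normc_ge_Re. Qed.

Lemma normc_Im x : `|complex.Im x| <= normc x.
Proof.
case: x => a b /=; rewrite -sqrtr_sqr ler_sqrt ?addr_ge0 ?sqr_ge0//.
by rewrite lerDr sqr_ge0.
Qed.

Lemma normc_le_ReIm x : normc x <= `|complex.Re x| + `|complex.Im x|.
Proof.
rewrite {1}[x]complexE (le_trans (normcD _ _))// normcM !normc_real.
rewrite (_ : normc 'i%C = 1) ?mul1r//=.
by rewrite /normc expr0n expr1n add0r sqrtr1.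
Qed.

Lemma Re_sum (I : Type) (r : seq I) (P : pred I) (F : I -> C) :
  complex.Re (\sum_(i <- r | P i) F i) = \sum_(i <- r | P i) complex.Re (F i).
Proof. by elim/big_rec2: _ => // i u v _ <-; case: (F i); case: v. Qed.

Lemma Im_sum (I : Type) (r : seq I) (P : pred I) (F : I -> C) :
  complex.Im (\sum_(i <- r | P i) F i) = \sum_(i <- r | P i) complex.Im (F i).
Proof. by elim/big_rec2: _ => // i u v _ <-; case: (F i); case: v. Qed.

End Modulus.

(** * Convergent complex series *)

Section Limits.
Variable R : realType.
Local Notation C := R[i].
Implicit Types (u v : nat -> C) (l : C) (q A B : R).

(** Lets error terms that decay geometrically be dropped from an inequality. *)
Lemma le_geometric_lim q A B D : 0 <= q < 1 ->
  (forall n, A <= B + D * q ^+ n) -> A <= B.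
Proof.
move=> /andP[q0 q1] h.
have : (fun n => B + D * q ^+ n) @ \oo --> B + D * 0.
  apply: cvgD; first exact: cvg_cst.
  apply: cvgM; first exact: cvg_cst.
  by apply: cvg_expr; rewrite ger0_norm.
rewrite mulr0 addr0 => cB.
rewrite -(cvg_lim _ cB)//; apply: limr_ge; first by apply/cvg_ex; exists B.
by near=> n; exact: h.
Unshelve. all: by end_near. Qed.

Lemma series_ord (V : zmodType) (u : nat -> V) n : series u n = \sum_(k < n) u k.
Proof. by rewrite /series /= big_mkord. Qed.

Lemma sums_toP u l : sums_to u l <->
  forall e : R, 0 < e -> \forall n \near \oo,
    normc (l - \sum_(k < n) u k) <= e.
Proof.
rewrite /sums_to; split.
  move=> /cvgrPdist_le h e e0.
  have /h : (0 : C) < e%:C by rewrite ltcR.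
  by apply: filterS => n; rewrite series_ord normr_normc lecR.
move=> h; apply/cvgrPdist_le => e e0.
have [e1 Ee] : exists e1, e = e1%:C.
  by apply/complex_realP; rewrite realE (ltW e0).
subst e; rewrite ltcR in e0.
by apply: filterS (h _ e0) => n; rewrite series_ord normr_normc lecR.
Qed.

Lemma sums_to_ext u v l : u =1 v -> sums_to u l -> sums_to v l.
Proof. by move=> /funext ->. Qed.

Lemma sums_toD u v l l' : sums_to u l -> sums_to v l' ->
  sums_to (fun n => u n + v n) (l + l').
Proof.
move=> h h'; rewrite /sums_to.
have -> : series (fun n => u n + v n) = series u \+ series v.
  by apply/funext => n; rewrite /= !series_ord big_split.
exact: (cvgD h h').
Qed.

Lemma sums_toZ a u l : sums_to u l -> sums_to (fun n => a * u n) (a * l).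
Proof.
move=> h; rewrite /sums_to.
have -> : series (fun n => a * u n) = (fun n => a * series u n).
  by apply/funext => n; rewrite /= !series_ord mulr_sumr.
apply: (cvgM _ h); exact: cvg_cst.
Qed.

Lemma sums_to0 : sums_to (fun=> 0 : C) 0.
Proof.
rewrite /sums_to.
have -> : series (fun=> 0 : C) = (fun=> 0).
  by apply/funext => n; rewrite /= !series_ord big1.
exact: cvg_cst.
Qed.

Lemma sums_toB u v l l' : sums_to u l -> sums_to v l' ->
  sums_to (fun n => u n - v n) (l - l').
Proof.
move=> h /(sums_toZ (a := -1)) h'; rewrite -mulN1r.
by apply: sums_to_ext (sums_toD h h') => n; rewrite mulN1r.
Qed.

Lemma sums_to_sum (I : eqType) (s : seq I) (u : I -> nat -> C) (l : I -> C) :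
  (forall i, i \in s -> sums_to (u i) (l i)) ->
  sums_to (fun n => \sum_(i <- s) u i n) (\sum_(i <- s) l i).
Proof.
elim: s => [|i s IH] h.
  by rewrite big_nil; apply: sums_to_ext sums_to0 => n; rewrite big_nil.
rewrite big_cons.
have hi := h i (mem_head _ _).
have hs := IH (fun j js => h j (mem_behead (s := i :: s) js)).
by apply: (sums_to_ext _ (sums_toD hi hs)) => n; rewrite big_cons.
Qed.

Lemma sums_to_shift u l N :
  sums_to (fun n => u (N + n)%N) l <-> sums_to u (l + \sum_(k < N) u k).
Proof.
have E n : \sum_(k < N + n) u k = \sum_(k < n) u (N + k)%N + \sum_(k < N) u k.
  by rewrite big_split_ord /= addrC.
split=> /sums_toP h; apply/sums_toP => e e0.
  have [M _ hM] := h _ e0; exists (N + M)%N => // n /= Mn.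
  have Nn : (N <= n)%N by rewrite (leq_trans (leq_addr M N)).
  rewrite -(subnKC Nn) E opprD addrACA subrr addr0.
  by apply: hM; rewrite /= leq_subRL.
have [M _ hM] := h _ e0; exists M => // n /= Mn.
have := hM (N + n)%N; rewrite /= E opprD addrACA subrr addr0; apply.
by rewrite (leq_trans Mn)// leq_addl.
Qed.

(** Closed discs are closed, so a bound on the late partial sums passes to
    the sum. *)
Lemma sums_to_le u l a B N : sums_to u l ->
  (forall n, (N <= n)%N -> normc (\sum_(k < n) u k - a) <= B) ->
  normc (l - a) <= B.
Proof.
move=> /sums_toP h hB; apply/ler_addgt0Pr => e e0.
have [M _ hM] := h _ e0.
have := hM (maxn M N); rewrite /= leq_maxl => /(_ isT) h1.
have := hB (maxn M N); rewrite leq_maxr => /(_ isT) h2.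
apply: le_trans (normcBD _ (\sum_(k < maxn M N) u k) _) _.
by rewrite addrC lerD.
Qed.

Lemma sums_to_unique u l l' : sums_to u l -> sums_to u l' -> l = l'.
Proof.
move=> h /sums_toP h'; apply/eqP; rewrite -subr_eq0 -normc_eq0.
rewrite eq_le normc_ge0 andbT; apply/ler_addgt0Pr => e e0; rewrite add0r.
have [M _ hM] := h' _ e0; apply: (sums_to_le (N := M) h) => n Mn.
by rewrite normcB; exact: hM.
Qed.

Lemma sums_to_geo_bound u l A q : 0 <= q < 1 ->
  (forall n, normc (l - \sum_(k < n) u k) <= A * q ^+ n) -> sums_to u l.
Proof.
move=> /andP[q0 q1] h; apply/sums_toP => e e0.
have : (fun n => A * q ^+ n) @ \oo --> A * 0.
  apply: cvgM; first exact: cvg_cst.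
  by apply: cvg_expr; rewrite ger0_norm.
rewrite mulr0 => /cvgrPdist_le /(_ _ e0); apply: filterS => n.
rewrite sub0r normrN; apply: le_trans.
by rewrite (le_trans (h n))// ler_norm.
Qed.

Lemma geometric_partial q n : 0 <= q < 1 -> \sum_(k < n) q ^+ k <= (1 - q)^-1.
Proof.
move=> /andP[q0 q1]; have q1' : 0 < 1 - q by rewrite subr_gt0.
rewrite -[_^-1]mul1r ler_pdivlMr// mulrC.
have := subrX1 q n => E.
have -> : (1 - q) * \sum_(k < n) q ^+ k = 1 - q ^+ n by lra.
by rewrite lerBlDr lerDl exprn_ge0.
Qed.

Lemma geometric_tail u A q N n : 0 <= q < 1 -> (N <= n)%N ->
  (forall k, normc (u k) <= A * q ^+ k) ->
  normc (\sum_(k < n) u k - \sum_(k < N) u k) <= A / (1 - q) * q ^+ N.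
Proof.
move=> q01 /subnKC <- h; have /andP[q0 q1] := q01.
have A0 : 0 <= A.
  by have := le_trans (normc_ge0 _) (h 0%N); rewrite expr0 mulr1.
rewrite big_split_ord /= addrAC subrr add0r (le_trans (normc_sum _ _ _))//.
apply: (@le_trans _ _ (\sum_(i < n - N) A * q ^+ N * q ^+ i)).
  by apply: ler_sum => i _; rewrite -mulrA -exprD.
rewrite -mulr_sumr mulrAC ler_wpM2r ?exprn_ge0// ler_wpM2l//.
exact: geometric_partial.
Qed.

Lemma sums_to_geo_le u l A q : 0 <= q < 1 ->
  (forall k, normc (u k) <= A * q ^+ k) -> sums_to u l ->
  forall N, normc (l - \sum_(k < N) u k) <= A / (1 - q) * q ^+ N.
Proof.
move=> q01 h ul N; apply: (sums_to_le (N := N) ul) => n Nn.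
exact: geometric_tail.
Qed.

Lemma sums_to_geo_norm u l A q : 0 <= q < 1 ->
  (forall k, normc (u k) <= A * q ^+ k) -> sums_to u l ->
  normc l <= A / (1 - q).
Proof.
move=> q01 h ul; have := sums_to_geo_le q01 h ul 0.
by rewrite big_ord0 subr0 expr0 mulr1.
Qed.

Lemma is_cvg_series_geo (v : nat -> R) A q : 0 <= q < 1 ->
  (forall k, `|v k| <= A * q ^+ k) -> cvgn (series v).
Proof.
move=> /andP[q0 q1] h; apply: normed_cvg.
have cg : cvgn (series (geometric A q)).
  by apply: is_cvg_geometric_series; rewrite ger0_norm.
apply: (series_le_cvg _ _ _ cg) => // n; first exact: normr_ge0.
exact: le_trans (normr_ge0 _) (h n).
Qed.

Lemma sums_to_ReIm (u : nat -> C) a b :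
  series (fun k => complex.Re (u k)) @ \oo --> a ->
  series (fun k => complex.Im (u k)) @ \oo --> b ->
  sums_to u (a +i* b).
Proof.
move=> cRe cIm; apply/sums_toP => e e0.
have e20 : 0 < e / 2 by rewrite divr_gt0.
move/cvgrPdist_le : cRe => /(_ _ e20) [M1 _ hR].
move/cvgrPdist_le : cIm => /(_ _ e20) [M2 _ hI].
exists (maxn M1 M2) => // n /=; rewrite geq_max => /andP[/hR + /hI].
rewrite /= !series_ord -Re_sum -Im_sum => {}hR {}hI.
rewrite (le_trans (normc_le_ReIm _))// [e]splitr lerD//.
  by move: hR; case: (\sum_(k < n) u k).
by move: hI; case: (\sum_(k < n) u k).
Qed.

(** Completeness of the complex numbers, by comparison with a geometric
    series on the real and on the imaginary part. *)
Lemma sums_to_geo_ex u A q : 0 <= q < 1 ->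
  (forall k, normc (u k) <= A * q ^+ k) -> exists l, sums_to u l.
Proof.
move=> q01 h.
have cRe : cvgn (series (fun k => complex.Re (u k))).
  apply: is_cvg_series_geo q01 _ => k.
  exact: le_trans (normc_Re _) (h k).
have cIm : cvgn (series (fun k => complex.Im (u k))).
  apply: is_cvg_series_geo q01 _ => k.
  exact: le_trans (normc_Im _) (h k).
exists (limn (series (fun k => complex.Re (u k))) +i*
        limn (series (fun k => complex.Im (u k)))).
exact: sums_to_ReIm.
Qed.

End Limits.

(** * Functions with an absolutely summable power series *)

Section PowerSeries.
Variable R : realType.
Local Notation C := R[i].
Implicit Types (g h : C -> C) (p w s : C) (r m q : R) (c : nat -> C).

(** The bound [m] on the partial sums of [|c_k| r ^ k] is an l1 norm.  It is
    submultiplicative and it bounds the coefficients as well as the values, so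
    that no integral formula is needed to pass from one to the other. *)
Definition expands g p r m c : Prop :=
  (forall n, \sum_(k < n) normc (c k) * r ^+ k <= m) /\
  (forall w, normc w < r -> sums_to (fun k => c k * w ^+ k) (g (p + w))).

Definition analytic_at g p : Prop :=
  exists r m c, 0 < r /\ expands g p r m c.

Lemma expands_ge0 g p r m c : expands g p r m c -> 0 <= m.
Proof. by move=> [/(_ 0%N)]; rewrite big_ord0. Qed.

(** On the smaller circle of radius [|w|] the [k]-th term of the l1 norm gains
    a factor [(|w| / r) ^ k], which is at most [(|w| / r) ^ n] on the tail. *)
Lemma expands_tail g p r m c w n : 0 < r -> expands g p r m c ->
  normc w < r ->
  normc (g (p + w) - \sum_(k < n) c k * w ^+ k) <= m * (normc w / r) ^+ n.
Proof.
move=> r0 [hm hs] wr; apply: (sums_to_le (N := n) (hs _ wr)) => K nK.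
have q0 : 0 <= normc w / r by rewrite divr_ge0 ?normc_ge0// ltW.
have q1 : normc w / r <= 1 by rewrite ler_pdivrMr// mul1r ltW.
have wE : normc w = r * (normc w / r) by rewrite mulrC divfK// gt_eqF.
rewrite -(subnKC nK) big_split_ord /= addrAC subrr add0r.
rewrite (le_trans (normc_sum _ _ _))//.
apply: (@le_trans _ _ (\sum_(i < K - n) (normc (c (n + i)%N) * r ^+ (n + i))
     * (normc w / r) ^+ n)).
  apply: ler_sum => i _; rewrite normcM normcX [in X in X <= _]wE exprMn mulrA.
  rewrite ler_wpM2l ?mulr_ge0 ?normc_ge0 ?exprn_ge0 ?(ltW r0)//.
  by rewrite exprD ler_piMr ?exprn_ge0 ?exprn_ile1.
rewrite -mulr_suml ler_wpM2r ?exprn_ge0//.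
apply: le_trans (hm K); rewrite -[in leRHS](subnKC nK) big_split_ord /= lerDr.
by apply: sumr_ge0 => i _; rewrite mulr_ge0 ?normc_ge0 ?exprn_ge0 ?(ltW r0).
Qed.

Lemma expands_le g p r m c w : 0 < r -> expands g p r m c -> normc w < r ->
  normc (g (p + w)) <= m.
Proof.
move=> r0 hg wr; have := expands_tail 0 r0 hg wr.
by rewrite big_ord0 subr0 expr0 mulr1.
Qed.

Lemma expands_tail_at g p r m c s n : 0 < r -> expands g p r m c ->
  normc (s - p) < r ->
  normc (g s - \sum_(k < n) c k * (s - p) ^+ k) <= m * (normc (s - p) / r) ^+ n.
Proof. by move=> r0 eg /(expands_tail n r0 eg); rewrite subrKC. Qed.

Lemma expands_le_at g p r m c s : 0 < r -> expands g p r m c ->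
  normc (s - p) < r -> normc (g s) <= m.
Proof. by move=> r0 eg /(expands_le r0 eg); rewrite subrKC. Qed.

Lemma expands_sums_at g p r m c s : expands g p r m c ->
  normc (s - p) < r -> sums_to (fun k => c k * (s - p) ^+ k) (g s).
Proof. by move=> [_ gs] /gs; rewrite subrKC. Qed.

Lemma expands_val g p r m c : 0 < r -> expands g p r m c -> g p = c 0%N.
Proof.
move=> r0 hg; apply/eqP; rewrite -subr_eq0 -normc_eq0 eq_le normc_ge0 andbT.
have w0 : normc (0 : C) < r by rewrite normc0.
have := expands_tail 1 r0 hg w0.
by rewrite addr0 big_ord1 expr0 mulr1 normc0 mul0r expr1 mulr0.
Qed.

Lemma expands_shrink g p r r' m c : 0 <= r' <= r -> expands g p r m c ->
  expands g p r' m c.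
Proof.
move=> /andP[r0 rr] [hm hs]; split=> [n|w wr].
  apply: le_trans (hm n); apply: ler_sum => k _.
  by rewrite ler_wpM2l ?normc_ge0 ?lerXn2r ?nnegrE ?(le_trans r0).
exact/hs/(lt_le_trans wr).
Qed.

Lemma expands_mono g p r m m' c : m <= m' -> expands g p r m c ->
  expands g p r m' c.
Proof.
by move=> mm [hm hs]; split; [move=> n; exact: le_trans (hm n) mm|exact: hs].
Qed.

Lemma expands_ext g h p r m c : (forall s, normc (s - p) < r -> g s = h s) ->
  expands g p r m c -> expands h p r m c.
Proof.
move=> gh [hm hs]; split; [exact: hm|move=> w wr].
have <- : g (p + w) = h (p + w) by apply: gh; rewrite addrC addKr.
exact: hs.
Qed.

Lemma analytic_ext g h p : (forall s, g s = h s) ->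
  analytic_at g p -> analytic_at h p.
Proof. by move=> /funext ->. Qed.

Lemma sums_to_finite (u : nat -> C) N : (forall k, (N <= k)%N -> u k = 0) ->
  sums_to u (\sum_(k < N) u k).
Proof.
move=> u0; rewrite -[X in sums_to u X]add0r; apply/sums_to_shift.
by apply: sums_to_ext (@sums_to0 R) => n; rewrite u0// leq_addr.
Qed.

Lemma expands_cst a p r : 0 <= r ->
  expands (fun=> a) p r (normc a) (fun k => if k == 0%N then a else 0).
Proof.
move=> r0; split=> [[|n]|w wr].
- by rewrite big_ord0 normc_ge0.
- rewrite big_ord_recl /= expr0 mulr1 big1 ?addr0// => i _.
  by rewrite /= normc0 mul0r.
- rewrite [X in sums_to _ X](_ : _ =
    \sum_(k < 1) (if k == 0%N :> nat then a else 0) * w ^+ k).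
    by apply: sums_to_finite => -[|k]//= _; rewrite mul0r.
  by rewrite big_ord1 /= expr0 mulr1.
Qed.

Lemma expands_id p r : 0 <= r -> expands id p r (normc p + r)
  (fun k => if k == 0%N then p else if k == 1%N then 1 else 0).
Proof.
move=> r0; split=> [[|[|n]]|w wr].
- by rewrite big_ord0 addr_ge0 ?normc_ge0.
- by rewrite big_ord1 /= expr0 mulr1 lerDl.
- rewrite !big_ord_recl /= expr0 mulr1 normc1 mul1r expr1 big1 ?addr0// => i _.
  by rewrite /= normc0 mul0r.
- rewrite [X in sums_to _ X](_ : _ = \sum_(k < 2)
    (if k == 0%N :> nat then p else if k == 1%N :> nat then 1 else 0) * w ^+ k).
    by apply: sums_to_finite => -[|[|k]]//= _; rewrite mul0r.
  by rewrite !big_ord_recl big_ord0 /= expr0 mulr1 expr1 mul1r addr0.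
Qed.

Lemma expandsD g h p r m m' c c' : expands g p r m c -> expands h p r m' c' ->
  0 <= r -> expands (fun s => g s + h s) p r (m + m') (fun k => c k + c' k).
Proof.
move=> [gm gs] [hm hs] r0; split=> [n|w wr].
  apply: le_trans (lerD (gm n) (hm n)); rewrite -big_split; apply: ler_sum => k _.
  by rewrite /= -mulrDl ler_wpM2r ?exprn_ge0 ?normcD.
apply: sums_to_ext (sums_toD (gs _ wr) (hs _ wr)) => k.
by rewrite mulrDl.
Qed.

Lemma expandsZ a g p r m c : 0 <= r -> expands g p r m c ->
  expands (fun s => a * g s) p r (normc a * m) (fun k => a * c k).
Proof.
move=> r0 [gm gs]; split=> [n|w wr].
  apply: le_trans (ler_wpM2l (normc_ge0 a) (gm n)); rewrite mulr_sumr.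
  by apply: ler_sum => k _; rewrite normcM mulrA.
apply: (sums_to_ext _ (sums_toZ (a := a) (gs _ wr))) => k.
by rewrite mulrA.
Qed.

Lemma sum_triangle (V : pzRingType) (a b : nat -> V) n :
  \sum_(k < n) \sum_(i < k.+1) a i * b (k - i)%N =
  \sum_(i < n) a i * \sum_(j < n - i) b j.
Proof.
elim: n => [|n IH]; first by rewrite !big_ord0.
rewrite big_ord_recr [RHS]big_ord_recr /= subSnn big_ord1 IH [X in _ + X = _]big_ord_recr /=.
rewrite subnn addrA -big_split /=; congr (_ + _).
apply: eq_bigr => i _; rewrite -mulrDr subSn ?(ltnW (ltn_ord i))//.
by rewrite big_ord_recr.
Qed.

(** The Cauchy product.  Its partial sum of order [n] is
    [sum_(i < n) c_i w ^ i * (sum_(j < n - i) c'_j w ^ j)], which differs from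
    the product of the two values only by tails of the two series. *)
Lemma expandsM g h p r m m' c c' : 0 < r -> expands g p r m c ->
  expands h p r m' c' ->
  expands (fun s => g s * h s) p r (m * m')
    (fun k => \sum_(i < k.+1) c i * c' (k - i)%N).
Proof.
move=> r0 eg eh; have [gm gs] := eg; have [hm hs] := eh.
split=> [n|w wr].
  apply: (@le_trans _ _ (\sum_(k < n) \sum_(i < k.+1)
     (normc (c i) * r ^+ i) * (normc (c' (k - i)%N) * r ^+ (k - i)))).
    apply: ler_sum => k _; apply: le_trans (ler_wpM2r (exprn_ge0 _ (ltW r0)) (normc_sum _ _ _)) _.
    rewrite mulr_suml; apply: ler_sum => i _.
    by rewrite normcM mulrACA -exprD subnKC // -ltnS.
  rewrite (sum_triangle (fun i => normc (c i) * r ^+ i)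
     (fun i => normc (c' i) * r ^+ i)).
  apply: le_trans (_ : \sum_(i < n) (normc (c i) * r ^+ i) * m' <= _).
    apply: ler_sum => i _; rewrite ler_wpM2l//.
    by rewrite mulr_ge0 ?normc_ge0 ?exprn_ge0 ?(ltW r0).
  by rewrite -mulr_suml ler_wpM2r// (expands_ge0 eh).
set q := normc w / r.
have q0 : 0 <= q by rewrite divr_ge0 ?normc_ge0// ltW.
have q1 : q < 1 by rewrite ltr_pdivrMr// mul1r.
have wE : normc w = r * q by rewrite mulrC divfK// gt_eqF.
apply: (@sums_to_geo_bound _ _ _ (m * m' + m * m') q); first by rewrite q0.
move=> n.
have -> : \sum_(k < n) (\sum_(i < k.+1) c i * c' (k - i)%N) * w ^+ k =
    \sum_(i < n) (c i * w ^+ i) * \sum_(j < n - i) c' j * w ^+ j.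
  rewrite -(sum_triangle (fun i => c i * w ^+ i) (fun i => c' i * w ^+ i)).
  apply: eq_bigr => k _; rewrite mulr_suml; apply: eq_bigr => i _.
  by rewrite mulrACA -exprD subnKC // -ltnS.
have -> : g (p + w) * h (p + w) -
    \sum_(i < n) c i * w ^+ i * \sum_(j < n - i) c' j * w ^+ j =
   (g (p + w) - \sum_(i < n) c i * w ^+ i) * h (p + w) +
   \sum_(i < n) c i * w ^+ i * (h (p + w) - \sum_(j < n - i) c' j * w ^+ j).
  rewrite mulrBl -addrA; congr (_ + _).
  under [X in _ = _ + X]eq_bigr do rewrite mulrBr.
  by rewrite sumrB mulr_suml addKr.
apply: le_trans (normcD _ _) _; rewrite [leRHS]mulrDl lerD//.
  rewrite normcM mulrAC ler_pM ?normc_ge0//; first exact: expands_tail r0 _ wr.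
  exact: expands_le r0 eh wr.
apply: le_trans (normc_sum _ _ _) _.
apply: le_trans (_ : \sum_(i < n) (normc (c i) * r ^+ i) * (m' * q ^+ n) <= _).
  apply: ler_sum => i _; rewrite normcM normcM normcX {1}wE exprMn -!mulrA.
  rewrite ler_wpM2l ?normc_ge0// ler_wpM2l ?exprn_ge0 ?(ltW r0)//.
  have -> : q ^+ n = q ^+ i * q ^+ (n - i) by rewrite -exprD subnKC// ltnW.
  by rewrite mulrCA ler_wpM2l ?exprn_ge0//; exact: expands_tail r0 _ wr.
rewrite -mulr_suml -mulrA ler_wpM2r// mulr_ge0 ?exprn_ge0//.
exact: expands_ge0 eh.
Qed.

Lemma analytic_cst a p : analytic_at (fun=> a) p.
Proof.
by exists 1, (normc a); eexists; split => //; apply: expands_cst.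
Qed.

Lemma analytic_id p : analytic_at id p.
Proof. by exists 1; do 2 eexists; split => //; apply: expands_id. Qed.

Lemma analyticD g h p : analytic_at g p -> analytic_at h p ->
  analytic_at (fun s => g s + h s) p.
Proof.
move=> [r [m [c [r0 eg]]]] [r' [m' [c' [r'0 eh]]]].
have r1 : 0 < Num.min r r' by rewrite lt_min r0.
have := @expandsD g h p (Num.min r r') m m' c c'.
move=> E; exists (Num.min r r'); do 2 eexists; split => //; apply: E; last exact: ltW.
- by apply: expands_shrink eg; rewrite ge_min lexx (ltW r1).
- by apply: expands_shrink eh; rewrite ge_min lexx orbT (ltW r1).
Qed.

Lemma analyticM g h p : analytic_at g p -> analytic_at h p ->
  analytic_at (fun s => g s * h s) p.
Proof.
move=> [r [m [c [r0 eg]]]] [r' [m' [c' [r'0 eh]]]].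
have r1 : 0 < Num.min r r' by rewrite lt_min r0.
have := @expandsM g h p (Num.min r r') m m' c c' r1.
move=> E; exists (Num.min r r'); do 2 eexists; split => //; apply: E.
- by apply: expands_shrink eg; rewrite ge_min lexx (ltW r1).
- by apply: expands_shrink eh; rewrite ge_min lexx orbT (ltW r1).
Qed.

Lemma analyticZ a g p : analytic_at g p -> analytic_at (fun s => a * g s) p.
Proof. by apply: analyticM; exact: analytic_cst. Qed.

Lemma analyticN g p : analytic_at g p -> analytic_at (fun s => - g s) p.
Proof. by move=> /(analyticZ (-1)); apply: analytic_ext => s; rewrite mulN1r. Qed.

Lemma analyticB g h p : analytic_at g p -> analytic_at h p ->
  analytic_at (fun s => g s - h s) p.
Proof. by move=> hg /analyticN; exact: analyticD. Qed.

Lemma analytic_sum (I : Type) (l : seq I) (P : pred I) (f : I -> C -> C) p :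
  (forall i, analytic_at (f i) p) ->
  analytic_at (fun s => \sum_(i <- l | P i) f i s) p.
Proof.
move=> hf; elim: l => [|i l IH].
  by apply: analytic_ext (analytic_cst 0 p) => s; rewrite big_nil.
case Pi : (P i); last by apply: analytic_ext IH => s; rewrite big_cons Pi.
by apply: analytic_ext (analyticD (hf i) IH) => s; rewrite big_cons Pi.
Qed.

Lemma analyticX g n p : analytic_at g p -> analytic_at (fun s => g s ^+ n) p.
Proof.
move=> hg; elim: n => [|n IH].
  by apply: analytic_ext (analytic_cst 1 p) => s; rewrite expr0.
by apply: analytic_ext (analyticM hg IH) => s; rewrite exprS.
Qed.

Lemma analytic_shift g a p : analytic_at g (p + a) ->
  analytic_at (fun s => g (s + a)) p.
Proof.
move=> [r [m [c [r0 [hm hs]]]]]; exists r, m, c; split; [exact: r0|].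
split; [exact: hm|move=> w wr].
by rewrite addrAC; exact: hs.
Qed.

End PowerSeries.

(** * Inverses, locally dominated sums and zeros of analytic functions *)

Section PowerSeriesTheorems.
Variable R : realType.
Local Notation C := R[i].
Implicit Types (g h : C -> C) (p w s : C) (r m q : R) (c : nat -> C).

Lemma sums_to_geometric (x : C) : normc x < 1 ->
  sums_to (fun n => x ^+ n) (1 - x)^-1.
Proof.
move=> x1; apply: (@sums_to_geo_bound _ _ _ (normc (1 - x)^-1) (normc x)).
  by rewrite normc_ge0.
move=> n; have x0 : 1 - x != 0.
  rewrite subr_eq0; apply/eqP => E; move: x1.
  by rewrite -E normc1 ltxx.
have -> : (1 - x)^-1 - \sum_(k < n) x ^+ k = (1 - x)^-1 * x ^+ n.
  have E : (1 - x) * \sum_(k < n) x ^+ k = 1 - x ^+ n.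
    by rewrite -opprB mulNr -subrX1 opprB.
  apply: (mulfI x0); rewrite mulrBr E mulrA divff// mul1r.
  by rewrite opprB addrC subrK.
by rewrite normcM normcX.
Qed.

(** Weierstrass' theorem when the l1 norms decay geometrically: the
    coefficients are summed over [n], and [expands_tail] bounds the tails of
    the power series uniformly enough to exchange the two summations. *)
Lemma expands_series (f : nat -> C -> C) g p r A q (c : nat -> nat -> C) :
  0 < r -> 0 <= q < 1 ->
  (forall n, expands (f n) p r (A * q ^+ n) (c n)) ->
  (forall s, normc (s - p) < r -> sums_to (f ^~ s) (g s)) ->
  exists c', expands g p r (A / (1 - q)) c'.
Proof.
move=> r0 q01 hf hg.
have cle n k : normc (c n k) * r ^+ k <= A * q ^+ n.
  have [/(_ k.+1) + _] := hf n; apply: le_trans.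
  rewrite big_ord_recr /= lerDr sumr_ge0// => i _.
  by rewrite mulr_ge0 ?normc_ge0 ?exprn_ge0 ?(ltW r0).
have cle' k n : normc (c n k) <= A / r ^+ k * q ^+ n.
  by rewrite mulrAC ler_pdivlMr ?exprn_gt0//.
have /choice[c' hc'] : forall k, exists l, sums_to (c ^~ k) l.
  by move=> k; exact: sums_to_geo_ex q01 (cle' k).
exists c'; split=> [K|w wr].
  apply: (@le_geometric_lim _ q _ _ (\sum_(k < K) (A / r ^+ k / (1 - q)) * r ^+ k)) => //.
  move=> N; rewrite mulr_suml.
  apply: (@le_trans _ _ (\sum_(k < K) \sum_(n < N) normc (c n k) * r ^+ k +
    \sum_(k < K) A / r ^+ k / (1 - q) * r ^+ k * q ^+ N)).
    rewrite -big_split; apply: ler_sum => k _ /=.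
    rewrite -mulr_suml [X in _ + X]mulrAC -mulrDl ler_wpM2r ?exprn_ge0 ?(ltW r0)//.
    apply: (@le_trans _ _ (normc (\sum_(n < N) c n k) +
                           normc (c' k - \sum_(n < N) c n k))).
      by rewrite -{1}[c' k](subrKC (\sum_(n < N) c n k)) normcD.
    rewrite lerD ?normc_sum//.
    by apply: (sums_to_geo_le q01 (cle' k) (hc' k)).
  rewrite lerD2r exchange_big /=.
  apply: (@le_trans _ _ (\sum_(n < N) A * q ^+ n)).
    by apply: ler_sum => n _; have [+ _] := hf n; exact.
  rewrite -mulr_sumr ler_wpM2l ?geometric_partial//.
  by have := expands_ge0 (hf 0%N); rewrite expr0 mulr1.
have t0 : 0 <= normc w / r by rewrite divr_ge0 ?normc_ge0// ltW.
have t1 : normc w / r < 1 by rewrite ltr_pdivrMr// mul1r.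
apply: (@sums_to_geo_bound _ _ _ (A / (1 - q)) (normc w / r)).
  by rewrite t0.
move=> K.
have S : sums_to (fun n => f n (p + w) - \sum_(k < K) c n k * w ^+ k)
  (g (p + w) - \sum_(k < K) c' k * w ^+ k).
  apply: sums_toB; first by apply: hg; rewrite addrC addKr.
  apply: (@sums_to_sum _ _ _ (fun k n => c n (nat_of_ord k) * w ^+ k)) => k _.
  rewrite mulrC; apply: sums_to_ext (sums_toZ (a := w ^+ k) (hc' k)) => n.
  by rewrite mulrC.
rewrite mulrAC; apply: sums_to_geo_norm q01 _ S => n.
by rewrite mulrAC; exact: expands_tail r0 (hf n) wr.
Qed.

(** Without a constant coefficient every term of the l1 norm contains a factor
    [r], so that shrinking the disc makes the norm small; this is what lets the
    geometric series of [analyticV] converge. *)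
Lemma expands_small g p r m c t : 0 <= t <= 1 -> 0 < r -> expands g p r m c ->
  g p = 0 -> expands g p (t * r) (t * m) c.
Proof.
move=> /andP[t0 t1] r0 eg g0; have [gm gs] := eg; split=> [n|w wr].
  apply: le_trans (ler_wpM2l t0 (gm n)); rewrite mulr_sumr.
  apply: ler_sum => -[[|k] kn] _ /=.
    by rewrite -(expands_val r0 eg) g0 normc0 !mul0r mulr0.
  rewrite mulrCA ler_wpM2l ?normc_ge0// exprMn ler_wpM2r ?exprn_ge0 ?(ltW r0)//.
  by rewrite exprS ler_piMr ?exprn_ile1.
by apply: gs; apply: lt_le_trans wr _; rewrite ler_piMl// ltW.
Qed.

(** With [v = 1 - g / g(p)], the inverse is [g(p)^-1 * sum_n v ^ n] on a disc
    where the norm of [v] is at most 1/2. *)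
Lemma analyticV g p : analytic_at g p -> g p != 0 ->
  analytic_at (fun s => (g s)^-1) p.
Proof.
move=> ag gp0; pose v s := 1 - (g p)^-1 * g s.
have vp0 : v p = 0 by rewrite /v mulVf// subrr.
have [r [m [c [r0 ev]]]] : analytic_at v p.
  by apply: analyticB (analytic_cst _ _) (analyticZ _ ag).
have m0 := expands_ge0 ev.
(* small enough for [t * m <= 1/2], and defined when [m = 0] *)
pose t : R := (2 * (m + 1))^-1.
have m10 : 0 < 2 * (m + 1) by rewrite mulr_gt0// ltr_wpDl.
have t0 : 0 < t by rewrite invr_gt0.
have t1 : t <= 1 by rewrite /t invf_le1//; lra.
have tm : t * m <= 2^-1.
  rewrite /t mulrC ler_pdivrMr// mulrA mulVf// mul1r; lra.
have ev' : expands v p (t * r) 2^-1 c.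
  by apply: expands_mono tm _; apply: expands_small => //; rewrite (ltW t0).
have tr0 : 0 < t * r by rewrite mulr_gt0.
have q01 : 0 <= (2^-1 : R) < 1 by rewrite invr_ge0 ler0n invf_lt1// ltr1n.
have /choice[d hd] : forall n, exists d,
    expands (fun s => v s ^+ n) p (t * r) (1 * 2^-1 ^+ n) d.
  elim=> [|n [d IH]].
    eexists; have := @expands_cst _ 1 p _ (ltW tr0).
    by rewrite normc1 expr0 mulr1 => E; exact: E.
  have := expandsM tr0 ev' IH; rewrite !mul1r -exprS => E.
  eexists; apply: expands_ext E => s _; exact/esym/exprS.
have [e he] : exists e, expands (fun s => (1 - v s)^-1) p (t * r) (1 / (1 - 2^-1)) e.
  apply: (expands_series tr0 q01 hd) => s sp.
  apply: sums_to_geometric; apply: le_lt_trans (expands_le_at tr0 ev' sp) _.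
  by rewrite invf_lt1// ltr1n.
have /(analyticZ (g p)^-1) : analytic_at (fun s => (1 - v s)^-1) p.
  by exists (t * r), (1 / (1 - 2^-1)), e.
apply: analytic_ext => s; rewrite /v opprB addrC subrK invfM invrK.
by rewrite mulrA mulVf// mul1r.
Qed.


(** Dividing by [s - p] shifts the coefficients by one place. *)
Lemma expands_factor g p r m c : 0 < r -> expands g p r m c -> g p = 0 ->
  exists h, [/\ analytic_at h p, (forall s, g s = (s - p) * h s) & h p = c 1%N].
Proof.
move=> r0 eg g0; pose h s := if s == p then c 1%N else g s / (s - p).
have c0 : c 0%N = 0 by rewrite -(expands_val r0 eg).
exists h; split=> [|s|]; last by rewrite /h eqxx.
- exists r, (m / r), (fun k => c k.+1); split; first exact: r0.
  have [gm gs] := eg.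
  split=> [n|w wr].
    rewrite ler_pdivlMr// mulr_suml.
    apply: le_trans (gm n.+1); rewrite big_ord_recl /= c0 normc0 mul0r add0r.
    by apply: ler_sum => k _; rewrite -mulrA -exprSr.
  rewrite /h addrC addrK; have [->|w0] := eqVneq w 0.
    rewrite add0r eqxx [X in sums_to _ X](_ : _ = \sum_(k < 1) c k.+1 * 0 ^+ k).
      by apply: sums_to_finite => -[|k]//= _; rewrite expr0n mulr0.
    by rewrite big_ord1 expr0 mulr1.
  rewrite addrC -subr_eq0 [p + w]addrC addrK (negbTE w0).
  have := gs _ wr; rewrite -[g (p + w)](subrK (\sum_(k < 1) c k * w ^+ k)).
  move=> /(iffRL (sums_to_shift _ _ 1)); rewrite big_ord1 c0 mul0r subr0 [p + w]addrC.
  move=> /(sums_toZ (a := w^-1)); rewrite mulrC; apply: sums_to_ext => k.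
  by rewrite add1n exprS mulrCA mulKf.
- rewrite /h; case: eqVneq => [->|sp]; first by rewrite subrr mul0r.
  by rewrite mulrC divfK// subr_eq0.
Qed.

(** Close to [p] the first nonzero coefficient would dominate the tail. *)
Lemma expands_zero_coefs g p r m c : 0 < r -> expands g p r m c ->
  (forall e : R, 0 < e -> exists2 s, 0 < normc (s - p) < e & g s = 0) ->
  forall k, c k = 0.
Proof.
move=> r0 eg hz k.
elim/ltn_ind: k => k IH; apply/eqP; rewrite -normc_eq0 eq_le normc_ge0 andbT.
rewrite leNgt; apply/negP => ck.
have m0 := expands_ge0 eg.
(* inside this radius the tail is smaller than the [k]-th term; [m + 1] is
   there because [m] may be 0 *)
pose e := Num.min r (normc (c k) * r ^+ k.+1 / (m + 1)).
have e0 : 0 < e.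
  by rewrite lt_min r0 divr_gt0 ?mulr_gt0 ?exprn_gt0// ltr_wpDl.
have [s1 /andP[s10 s1e] gs1] := hz _ e0.
move: s1e; rewrite lt_min => /andP[s1r s1c].
have := expands_tail_at k.+1 r0 eg s1r; rewrite gs1 sub0r normc_opp.
rewrite big_ord_recr /= big1 ?add0r; last by move=> i _; rewrite IH// mul0r.
rewrite normcM normcX expr_div_n mulrA ler_pdivlMr ?exprn_gt0//.
rewrite mulrAC [normc (s1 - p) ^+ k.+1]exprS [leRHS]mulrA ler_pM2r ?exprn_gt0//.
apply/negP; rewrite -ltNge; move: s1c; rewrite ltr_pdivlMr ?ltr_wpDl//.
move=> h; apply: le_lt_trans h; rewrite mulrC ler_wpM2l ?normc_ge0//.
by rewrite lerDl.
Qed.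

Lemma analytic_isolated_zeros g p : analytic_at g p ->
  (forall e : R, 0 < e -> exists2 s, 0 < normc (s - p) < e & g s = 0) ->
  exists2 r, 0 < r & forall s, normc (s - p) < r -> g s = 0.
Proof.
move=> [r [m [c [r0 eg]]]] hz; exists r; first exact: r0.
move=> s sr; have c0 := expands_zero_coefs r0 eg hz.
have /sums_to_unique := expands_sums_at eg sr; apply.
by apply: sums_to_ext (@sums_to0 R) => k; rewrite c0 mul0r.
Qed.

End PowerSeriesTheorems.

(** * Complex powers of positive reals *)

Section Exponential.
Variable R : realType.
Local Notation C := R[i].
Implicit Types (p w s : C) (r t y : R).

Definition cexp (w : C) : C :=
  (expR (complex.Re w))%:C * (cos (complex.Im w) +i* sin (complex.Im w)).

Lemma cpowE t w : cpow t w = cexp (w * (ln t)%:C).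
Proof.
case: w => a b; rewrite /cpow /cexp /=.
by rewrite !mulr0 subr0 add0r.
Qed.

Lemma normc_cexp w : normc (cexp w) = expR (complex.Re w).
Proof.
rewrite normcM normc_real gtr0_norm ?expR_gt0// -[RHS]mulr1; congr (_ * _).
by rewrite /normc /= cos2Dsin2 sqrtr1.
Qed.

Lemma cexp0 : cexp 0 = 1.
Proof. by rewrite /cexp /= expR0 cos0 sin0 mul1r. Qed.

Lemma cexpD w s : cexp (w + s) = cexp w * cexp s.
Proof.
case: w s => a b [c d]; rewrite /cexp /= expRD cosD sinD rmorphM /=.
by apply/eqP; rewrite eq_complex /= ; apply/andP; split; apply/eqP; ring.
Qed.

Lemma exp_partial_le t n : 0 <= t -> \sum_(k < n) t ^+ k / k`!%:R <= expR t.
Proof.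
move=> t0; rewrite -(series_ord (exp_coeff t)).
apply: nondecreasing_cvgn_le; last exact: is_cvg_series_exp_coeff.
by apply: nondecreasing_series => k _ _; rewrite divr_ge0 ?exprn_ge0.
Qed.

Lemma sums_to_expR t : sums_to (fun k => t%:C ^+ k / k`!%:R) (expR t)%:C.
Proof.
have E k : t%:C ^+ k / k`!%:R = (t ^+ k / k`!%:R)%:C :> C.
  by rewrite rmorphM fmorphV rmorphXn /= rmorph_nat.
apply: sums_to_ReIm.
  under eq_fun do rewrite E; exact: is_cvg_series_exp_coeff.
under eq_fun do rewrite E /=.
rewrite (_ : series _ = fun=> 0); first exact: cvg_cst.
by apply/funext => n; rewrite series_ord big1.
Qed.

Lemma imaginary_exp y k : (0 +i* y) ^+ k =
  ((~~ odd k)%:R * (-1) ^+ k./2 * y ^+ k) +i* ((odd k)%:R * (-1) ^+ k.-1./2 * y ^+ k).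
Proof.
elim: k => [|k IH]; first by rewrite !expr0 /= !mulr1.
have od2 : odd k -> k./2 = k.-1./2 /\ uphalf k = (k.-1./2).+1.
  by case: (k) => // n /= on; rewrite uphalf_half (negbTE on).
have ev2 : ~~ odd k -> uphalf k = k./2 by move=> ok; rewrite uphalf_half (negbTE ok).
rewrite exprSr IH; apply/eqP; rewrite eq_complex /=.
case: (boolP (odd k)) od2 ev2 => /= ok od2 ev2.
  have [e1 e2] := od2 isT.
  by apply/andP; split; apply/eqP; rewrite ?e2 ?e1 ?exprS ?mulr0n ?mulr1n; ring.
by apply/andP; split; apply/eqP; rewrite ?ev2// ?exprS ?mulr0n ?mulr1n; ring.
Qed.

Lemma sums_to_cis y :
  sums_to (fun k => (0 +i* y) ^+ k / k`!%:R) (cos y +i* sin y).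
Proof.
have E k : (0 +i* y) ^+ k / k`!%:R = cos_coeff y k +i* sin_coeff y k :> C.
  have -> : (k`!%:R : C)^-1 = (k`!%:R^-1)%:C by rewrite fmorphV rmorph_nat.
  rewrite imaginary_exp /cos_coeff /sin_coeff /=.
  by apply/eqP; rewrite eq_complex /= !mulr0 subr0 add0r !eqxx.
apply: sums_to_ReIm.
  under eq_fun do rewrite E /=.
  by rewrite unlock; exact: is_cvg_series_cos_coeff.
under eq_fun do rewrite E /=.
by rewrite unlock; exact: is_cvg_series_sin_coeff.
Qed.

(** The functional equation is the Cauchy product of [exp (a t)] and
    [exp (b t)] as power series in an auxiliary variable [t], taken at [t = 1]. *)
Lemma exp_series : exists E : C -> C,
  (forall w, sums_to (fun k => w ^+ k / k`!%:R) (E w)) /\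
  (forall a b, E (a + b) = E a * E b).
Proof.
have nE (w : C) k : normc (w ^+ k / k`!%:R) = normc w ^+ k / k`!%:R.
  by rewrite normcM normcX normcV normc_nat.
have /choice[E hE] : forall w : C, exists l, sums_to (fun k => w ^+ k / k`!%:R) l.
  move=> w; apply: (@sums_to_geo_ex _ _ (expR (2 * normc w)) (2^-1)).
    by rewrite invr_ge0 ler0n invf_lt1// ltr1n.
  move=> k; rewrite nE exprVn ler_pdivlMr ?exprn_gt0//.
  have w0 : 0 <= 2 * normc w by rewrite mulr_ge0 ?normc_ge0.
  rewrite mulrAC -exprMn [normc w * 2]mulrC.
  apply: le_trans (exp_partial_le k.+1 w0); rewrite big_ord_recr /= lerDr.
  by apply: sumr_ge0 => i _; rewrite divr_ge0 ?exprn_ge0.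
exists E; split=> // a b.
have ex (x : C) r : 0 < r -> expands (fun s => E (x * s)) 0 r
    (expR (normc x * r)) (fun k => x ^+ k / k`!%:R).
  move=> r0; split=> [n|w wr].
    apply: le_trans (exp_partial_le n _); last by rewrite mulr_ge0 ?normc_ge0 ?ltW.
    by apply: ler_sum => k _; rewrite nE exprMn mulrAC.
  by rewrite add0r; apply: sums_to_ext (hE _) => k; rewrite exprMn mulrAC.
have := expandsM (ltr0Sn R 1) (ex a _ (ltr0Sn R 1)) (ex b _ (ltr0Sn R 1)).
move=> [_ /(_ 1)]; rewrite normc1 ltr1n => /(_ isT).
rewrite add0r !mulr1 => /sums_to_unique h; apply/esym/h => {h}.
apply: sums_to_ext (hE (a + b)) => k; rewrite expr1n mulr1 addrC exprDn mulr_suml.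
apply: eq_bigr => i _; have ik : (i <= k)%N by rewrite -ltnS.
have fact0 n : (n`!%:R : C) != 0 by rewrite pnatr_eq0 -lt0n fact_gt0.
rewrite -(bin_fact ik) !natrM -mulr_natr !invfM.
have b0 : ('C(k, i)%:R : C) != 0 by rewrite pnatr_eq0 -lt0n bin_gt0.
by field; rewrite b0 !fact0.
Qed.

(** The exponential series satisfies the functional equation of [cexp], and
    they agree on the real and on the imaginary axis. *)
Lemma sums_to_cexp w : sums_to (fun k => w ^+ k / k`!%:R) (cexp w).
Proof.
have [E [hE ED]] := exp_series.
suff -> : cexp w = E w by [].
case: w => a b; have -> : a +i* b = a%:C + (0 +i* b).
  by apply/eqP; rewrite eq_complex /= addr0 add0r !eqxx.
rewrite ED cexpD; congr (_ * _).
  rewrite /cexp /= cos0 sin0 mulr1.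
  exact: (sums_to_unique (@sums_to_expR a) (hE _)).
rewrite /cexp /= expR0 mul1r.
exact: (sums_to_unique (@sums_to_cis b) (hE _)).
Qed.

Lemma expands_cexp (a b p : C) r : 0 <= r ->
  expands (fun s => cexp (a * s + b)) p r
    (expR (complex.Re (a * p + b) + normc a * r))
    (fun k => cexp (a * p + b) * (a ^+ k / k`!%:R)).
Proof.
move=> r0; split=> [n|w wr].
  rewrite expRD.
  apply: le_trans (ler_wpM2l (expR_ge0 _) (exp_partial_le n (mulr_ge0 (normc_ge0 a) r0))).
  rewrite mulr_sumr; apply: ler_sum => k _.
  by rewrite normcM normc_cexp normcM normcX normcV normc_nat exprMn -[leLHS]mulrA [_ / _ * _]mulrAC.
rewrite mulrDr addrAC [cexp (_ + a * w)]cexpD.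
have h := sums_toZ (a := cexp (a * p + b)) (@sums_to_cexp (a * w)).
apply: (sums_to_ext _ h) => k; rewrite exprMn -mulrA; congr (_ * _).
by rewrite mulrAC.
Qed.

Lemma expands_cpow t p r : 0 < t -> 0 <= r ->
  expands (fun s => cpow t (- s)) p r
    (expR (- complex.Re p * ln t + `|ln t| * r))
    (fun k => cpow t (- p) * ((- (ln t)%:C) ^+ k / k`!%:R)).
Proof.
move=> t0 r0; have := @expands_cexp (- (ln t)%:C) 0 p r r0.
rewrite addr0 normc_opp normc_real.
have -> : complex.Re (- (ln t)%:C * p) = - complex.Re p * ln t.
  by case: p => a b /=; rewrite oppr0 mul0r subr0 mulNr mulrC mulNr.
rewrite (_ : cexp _ = cpow t (- p)); last by rewrite cpowE mulNr mulrC mulNr.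
apply: expands_ext => s _; rewrite cpowE addr0; congr cexp.
by rewrite mulNr mulrC mulNr.
Qed.

Lemma analytic_cpow t p : 0 < t -> analytic_at (fun s => cpow t (- s)) p.
Proof.
move=> t0; exists 1; do 2 eexists; split; first exact: ltr01.
exact: expands_cpow.
Qed.

Lemma normc_cpow t w : normc (cpow t w) = expR (complex.Re w * ln t).
Proof.
by rewrite cpowE normc_cexp; case: w => a b /=; rewrite mulr0 subr0.
Qed.

Lemma cpowD t w s : cpow t (w + s) = cpow t w * cpow t s.
Proof. by rewrite !cpowE mulrDl cexpD. Qed.

Lemma cpowM t y w : 0 < t -> 0 < y -> cpow (t * y) w = cpow t w * cpow y w.
Proof.
by move=> t0 y0; rewrite !cpowE lnM ?posrE// rmorphD mulrDr cexpD.
Qed.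

Lemma cpow_neq0 t w : cpow t w != 0.
Proof. by rewrite -normc_gt0 normc_cpow expR_gt0. Qed.

Lemma cpow_nat t n : 0 < t -> cpow t n%:R = t%:C ^+ n.
Proof.
move=> t0; rewrite cpowE -[n%:R * _](_ : (n%:R * ln t)%:C = _); last first.
  by rewrite rmorphM rmorph_nat.
rewrite /cexp /= cos0 sin0 mulr1 mulrC expRM_natr lnK ?posrE//.
by rewrite rmorphXn.
Qed.

End Exponential.

(** * Binomial coefficients with complex upper index *)

Section BinomialCoefficients.
Variable R : realType.
Local Notation C := R[i].
Implicit Types (p w s : C) (r t q rho e : R) (k : nat).

(** The absolute value of [binom(- rho, k)] for [rho >= 0]. *)
Definition rising_binom rho k : R := (\prod_(i < k) (rho + i%:R)) / k`!%:R.

Lemma rising_binom_ge0 rho k : 0 <= rho -> 0 <= rising_binom rho k.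
Proof.
by move=> r0; rewrite divr_ge0 ?ler0n// prodr_ge0// => i _; rewrite addr_ge0.
Qed.

Lemma rising_binomS rho k :
  rising_binom rho k.+1 = rising_binom rho k * ((rho + k%:R) / k.+1%:R).
Proof. by rewrite /rising_binom big_ord_recr /= factS natrM invfM; ring. Qed.

Lemma geometric_of_ratio (u : nat -> R) q k0 : 0 < q -> (forall k, 0 <= u k) ->
  (forall k, (k0 <= k)%N -> u k.+1 <= q * u k) ->
  exists A, forall k, u k <= A * q ^+ k.
Proof.
move=> q0 u0 h; exists (\sum_(i < k0.+1) u i / q ^+ i).
have small k : (k <= k0)%N -> u k <= (\sum_(i < k0.+1) u i / q ^+ i) * q ^+ k.
  move=> kk; rewrite -ler_pdivrMr ?exprn_gt0//.
  rewrite (bigD1 (inord k)) //= inordK// lerDl sumr_ge0// => i _.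
  by rewrite divr_ge0 ?u0 ?exprn_ge0 ?(ltW q0).
elim=> [|k IH]; first exact: small.
have [kk|kk] := leqP k.+1 k0; first exact: small.
by rewrite exprS mulrCA (le_trans (h _ _))// ler_pM2l.
Qed.

(** The ratio test: the quotient of consecutive terms tends to [t]. *)
Lemma rising_binom_geo rho t : 0 <= rho -> 0 <= t < 1 ->
  exists A q, 0 <= q < 1 /\ forall k, rising_binom rho k * t ^+ k <= A * q ^+ k.
Proof.
move=> r0 /andP[t0 t1]; (* any ratio strictly between [t] and 1 *)
pose q := (1 + t) / 2.
have q1 : q < 1 by rewrite /q; lra.
have q0 : 0 < q by rewrite /q; lra.
have qt : 0 < q - t by rewrite /q; lra.
have := @archi_boundP R (rho * t / (q - t)).
rewrite divr_ge0 ?mulr_ge0 ?(ltW qt)// => /(_ isT) hb.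
have [//|||A hA] := @geometric_of_ratio (fun k => rising_binom rho k * t ^+ k) q
  (Num.bound (rho * t / (q - t))).
- by move=> k; rewrite mulr_ge0 ?rising_binom_ge0 ?exprn_ge0.
- move=> k kb; rewrite rising_binomS exprS.
  rewrite [leLHS](_ : _ = rising_binom rho k * t ^+ k * ((rho + k%:R) * t / k.+1%:R));
    last by ring.
  have hg : 0 <= rising_binom rho k * t ^+ k.
    by rewrite mulr_ge0 ?rising_binom_ge0 ?exprn_ge0.
  rewrite [leRHS]mulrC (ler_wpM2l hg)//.
  rewrite ler_pdivrMr ?ltr0n//.
  have : rho * t < k%:R * (q - t).
    rewrite -ltr_pdivrMr//; apply: lt_le_trans hb _; by rewrite ler_nat.
  rewrite -natr1; nra.
by exists A, q; rewrite q1 (ltW q0).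
Qed.

Lemma cbinom0 w : cbinom w 0 = 1.
Proof. by rewrite /cbinom big_ord0 divr1. Qed.

Lemma natc_neq0 k : (k.+1%:R : C) != 0.
Proof. by rewrite pnatr_eq0. Qed.

Lemma cbinomS w k : k.+1%:R * cbinom w k.+1 = cbinom w k * (w - k%:R).
Proof.
rewrite /cbinom big_ord_recr /= factS natrM invfM.
by rewrite mulrCA mulVKf ?natc_neq0// mulrAC.
Qed.

(** Coefficient by coefficient, the derivative of the binomial series of
    exponent [w] is [w] times the series of exponent [w - 1]. *)
Lemma cbinom_absorb w k : k.+1%:R * cbinom w k.+1 = w * cbinom (w - 1) k.
Proof.
rewrite /cbinom big_ord_recl /= subr0 factS natrM invfM.
have -> : \prod_(i < k) (w - (bump 0 i)%:R) = \prod_(i < k) (w - 1 - i%:R).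
  by apply: eq_bigr => i _; rewrite /bump /= natrD opprD addrA.
by rewrite mulrCA mulVKf ?natc_neq0// mulrA.
Qed.

Lemma cbinom_pascal w k :
  cbinom w k.+1 = cbinom (w - 1) k.+1 + cbinom (w - 1) k.
Proof.
apply: (mulfI (natc_neq0 k)); rewrite cbinom_absorb mulrDr cbinomS.
by rewrite -natr1; ring.
Qed.

Lemma normc_cbinom w k : normc (cbinom w k) <= rising_binom (normc w) k.
Proof.
rewrite /cbinom /rising_binom normcM normcV normc_nat.
rewrite ler_wpM2r ?invr_ge0 ?ler0n//.
elim: k => [|k IH]; first by rewrite !big_ord0 normc1.
rewrite !big_ord_recr /= normcM ler_pM ?normc_ge0//.
by rewrite (le_trans (normcD _ _))// normc_opp normc_nat.
Qed.

(** A product of [k] affine functions of [s], the [i]-th one of norm at most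
    [(|p| + r + i) / (i + 1)]. *)
Lemma expands_cbinomN p r k : 0 < r ->
  exists c, expands (fun s => cbinom (- s) k) p r (rising_binom (normc p + r) k) c.
Proof.
move=> r0; elim: k => [|k [c IH]].
  eexists; have := @expands_cst R 1 p r (ltW r0); rewrite normc1.
  rewrite /rising_binom big_ord0 divr1; apply: expands_ext => s _.
  by rewrite cbinom0.
pose a : C := - (k.+1%:R)^-1; pose b : C := - k%:R / k.+1%:R.
have ab s : cbinom (- s) k.+1 = cbinom (- s) k * (a * s + b).
  apply: (mulfI (natc_neq0 k)); rewrite cbinomS /a /b.
  move: (k.+1%:R : C) (natc_neq0 k) => K K0.
  by field.
have Ea := expandsD (expandsM r0 (expands_cst a p (ltW r0)) (expands_id p (ltW r0)))
  (expands_cst b p (ltW r0)) (ltW r0).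
have E := expandsM r0 IH Ea.
eexists; apply: expands_ext (expands_mono _ E) => [s _|].
  by rewrite ab.
rewrite rising_binomS ler_wpM2l ?rising_binom_ge0 ?addr_ge0 ?normc_ge0 ?(ltW r0)//.
rewrite /a /b normcM !normc_opp !normcV !normc_nat.
by rewrite [_^-1 * _]mulrC -mulrDl.
Qed.

Lemma cbinom_sums w e : `|e| < 1 ->
  exists l, sums_to (fun k => cbinom w k * e%:C ^+ k) l.
Proof.
move=> e1; have e01 : 0 <= `|e| < 1 by rewrite normr_ge0.
have [A [q [q01 h]]] := rising_binom_geo (normc_ge0 w) e01.
apply: sums_to_geo_ex q01 _ => k; apply: le_trans (h k).
by rewrite normcM normcX normc_real ler_wpM2r ?exprn_ge0// normc_cbinom.
Qed.

End BinomialCoefficients.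

(** * The binomial series *)

Section BinomialSeries.
Variable R : realType.
Local Notation C := R[i].
Implicit Types (w v u : C) (e x : R) (f g : R -> R).

Lemma deriveM_fun f g x a b : is_derive x (1:R) f a -> is_derive x (1:R) g b ->
  is_derive x (1:R) (fun t => f t * g t) (a * g x + f x * b).
Proof.
move=> df dg; have := is_deriveM df dg; rewrite addrC => h.
by rewrite mulrC; exact: h.
Qed.

Lemma deriveB_fun f g x a b : is_derive x (1:R) f a -> is_derive x (1:R) g b ->
  is_derive x (1:R) (fun t => f t - g t) (a - b).
Proof. by move=> df dg; exact: is_deriveB df dg. Qed.

Lemma deriveD_fun f g x a b : is_derive x (1:R) f a -> is_derive x (1:R) g b ->
  is_derive x (1:R) (fun t => f t + g t) (a + b).
Proof. by move=> df dg; exact: is_deriveD df dg. Qed.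

Lemma derive_comp_fun f g x a b : is_derive (g x) (1:R) f a ->
  is_derive x (1:R) g b -> is_derive x (1:R) (fun t => f (g t)) (a * b).
Proof. by move=> df dg; exact: is_derive1_comp df dg. Qed.

Lemma derive_eq_fun f x a b : is_derive x (1:R) f a -> a = b ->
  is_derive x (1:R) f b.
Proof. by move=> h <-. Qed.

Lemma derive_ln1p x : -1 < x ->
  is_derive x (1:R) (fun t : R => ln (1 + t)) (1 + x)^-1.
Proof.
move=> x1; rewrite -[_^-1]mulr1; apply: derive_comp_fun.
  by apply: is_derive1_ln; lra.
by rewrite -[X in is_derive _ _ _ X]add0r; apply: deriveD_fun.
Qed.

Lemma derive_cpow_Re v x : -1 < x ->
  is_derive x (1:R) (fun t => complex.Re (cpow (1 + t) v))
    (complex.Re (v * cpow (1 + x) v) / (1 + x)).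
Proof.
move=> x1; have dl := derive_ln1p x1; case: v => a b.
have da : is_derive x (1:R) (fun t => a * ln (1 + t)) (a / (1 + x)).
  apply: derive_eq_fun (deriveM_fun (is_derive_cst a x 1) dl) _.
  by rewrite mul0r add0r.
have db : is_derive x (1:R) (fun t => b * ln (1 + t)) (b / (1 + x)).
  apply: derive_eq_fun (deriveM_fun (is_derive_cst b x 1) dl) _.
  by rewrite mul0r add0r.
have dE := @derive_comp_fun expR (fun t => a * ln (1 + t)) x _ _
  (is_derive_expR (a * ln (1 + x))) da.
have dC := @derive_comp_fun cos (fun t => b * ln (1 + t)) x _ _
  (is_derive_cos (b * ln (1 + x))) db.
have h := deriveM_fun dE dC.
rewrite (_ : (fun t => _) = fun t => expR (a * ln (1 + t)) * cos (b * ln (1 + t))).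
  apply: derive_eq_fun h _; rewrite /cpow /=; ring.
by apply/funext => t; rewrite /cpow /= mul0r subr0.
Qed.

Lemma derive_cpow_Im v x : -1 < x ->
  is_derive x (1:R) (fun t => complex.Im (cpow (1 + t) v))
    (complex.Im (v * cpow (1 + x) v) / (1 + x)).
Proof.
move=> x1; have dl := derive_ln1p x1; case: v => a b.
have da : is_derive x (1:R) (fun t => a * ln (1 + t)) (a / (1 + x)).
  apply: derive_eq_fun (deriveM_fun (is_derive_cst a x 1) dl) _.
  by rewrite mul0r add0r.
have db : is_derive x (1:R) (fun t => b * ln (1 + t)) (b / (1 + x)).
  apply: derive_eq_fun (deriveM_fun (is_derive_cst b x 1) dl) _.
  by rewrite mul0r add0r.
have dE := @derive_comp_fun expR (fun t => a * ln (1 + t)) x _ _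
  (is_derive_expR (a * ln (1 + x))) da.
have dS := @derive_comp_fun sin (fun t => b * ln (1 + t)) x _ _
  (is_derive_sin (b * ln (1 + x))) db.
have h := deriveM_fun dE dS.
rewrite (_ : (fun t => _) = fun t => expR (a * ln (1 + t)) * sin (b * ln (1 + t))).
  apply: derive_eq_fun h _; rewrite /cpow /=; ring.
by apply/funext => t; rewrite /cpow /= mul0r addr0.
Qed.

Lemma zero_derive_const f : (forall x, `|x| < 1 -> is_derive x (1:R) f 0) ->
  forall x, `|x| < 1 -> f x = f 0.
Proof.
move=> df.
suff h a b : a <= b -> -1 < a -> b < 1 -> f a = f b.
  move=> x; rewrite ltr_norml => /andP[x0 x1].
  have [x00|/ltW x00] := leP x 0; first by apply: h.
  by apply/esym/h => //; rewrite ltrN10.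
move=> ab a1 b1.
have d t : t \in `[a, b] -> `|t| < 1.
  rewrite in_itv /= ltr_norml => /andP[h1 h2].
  by rewrite (lt_le_trans a1 h1) (le_lt_trans h2 b1).
have [|||c _ /eqP] := @MVT_segment R f (fun=> 0) a b.
- exact: ab.
- by move=> t tab; apply/df/d; apply: subset_itv_oo_cc.
- by apply: derivable_within_continuous => t tab; apply/ex_derive/df/d.
by rewrite mul0r subr_eq0 => /eqP.
Qed.

(** Termwise differentiation is available for real power series.  Taking
    [Re (u * _)] with [u = 1] and [u = - i] gives the real and the imaginary
    part of the binomial series, and by [cbinom_absorb] the family indexed by
    [u] and [v] is stable under differentiation. *)
Definition binom_part u v e : R :=
  limn (pseries (fun k => complex.Re (u * cbinom v k)) e).

Lemma binom_part_cvg u v e : `|e| < 1 ->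
  cvgn (pseries (fun k => complex.Re (u * cbinom v k)) e).
Proof.
move=> e1; have e01 : 0 <= `|e| < 1 by rewrite normr_ge0.
have [A [q [q01 h]]] := rising_binom_geo (normc_ge0 v) e01.
apply: (@is_cvg_series_geo _ _ (normc u * A) q) => // k /=.
rewrite normrM normrX -mulrA; apply: le_trans (ler_wpM2l (normc_ge0 u) (h k)).
rewrite [leRHS]mulrA ler_wpM2r ?exprn_ge0//; apply: le_trans (normc_Re _) _.
by rewrite normcM ler_wpM2l ?normc_ge0 ?normc_cbinom.
Qed.

Lemma binom_part_diffs u v :
  pseries_diffs (fun k => complex.Re (u * cbinom v k)) =
  fun k => complex.Re (u * v * cbinom (v - 1) k).
Proof.
apply/funext => k; rewrite /pseries_diffs -mulrA -cbinom_absorb.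
have ReZ (n : nat) (z : C) : n%:R * complex.Re z = complex.Re (n%:R * z).
  by rewrite -(rmorph_nat (real_complex R)); case: z => a b /=; rewrite mul0r subr0.
by rewrite ReZ mulrCA.
Qed.

Lemma derive_binom_part u v e : `|e| < 1 ->
  is_derive e (1:R) (binom_part u v) (binom_part (u * v) (v - 1) e).
Proof.
move=> e1; (* a point of convergence strictly beyond [e] *)
pose K := (1 + `|e|) / 2.
have e0 := normr_ge0 e.
have K1 : `|K| < 1 by rewrite ger0_norm /K; lra.
rewrite /binom_part -binom_part_diffs.
apply: (@pseries_snd_diffs _ _ K); rewrite ?binom_part_diffs.
- exact: binom_part_cvg.
- exact: binom_part_cvg.
- exact: binom_part_cvg.
- by rewrite [ltRHS]ger0_norm /K; lra.
Qed.

Lemma binom_partE u v e l : sums_to (fun k => cbinom v k * e%:C ^+ k) l ->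
  binom_part u v e = complex.Re (u * l).
Proof.
move=> h; apply: cvg_lim => //.
move/(sums_toZ (a := u))/sums_toP : h => h; apply/cvgrPdist_le => eps e0.
apply: filterS (h _ e0) => n; apply: le_trans.
rewrite /pseries series_ord; apply: le_trans _ (normc_Re _).
have -> : complex.Re (u * l - \sum_(k < n) u * (cbinom v k * e%:C ^+ k)) =
   complex.Re (u * l) - complex.Re (\sum_(k < n) u * (cbinom v k * e%:C ^+ k)).
  by case: (u * l) (\sum_(k < n) _) => a b [c d].
rewrite Re_sum le_eqVlt; apply/orP; left; apply/eqP; congr (`| _ - _|).
apply: eq_bigr => k _; rewrite mulrA.
have -> : e%:C ^+ k = (e ^+ k)%:C by rewrite rmorphXn.
by rewrite /=; case: (u * cbinom v k) => a b /=; rewrite mulr0 subr0.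
Qed.

(** Pascal's rule; together with [derive_binom_part] it says that the sum [B]
    of the binomial series of exponent [w] satisfies [(1 + e) B' = w B]. *)
Lemma binom_sums_pascal w e l l' : sums_to (fun k => cbinom w k * e%:C ^+ k) l ->
  sums_to (fun k => cbinom (w - 1) k * e%:C ^+ k) l' -> l = (1 + e%:C) * l'.
Proof.
move=> h h'; pose u k := cbinom w k * e%:C ^+ k.
pose u' k := cbinom (w - 1) k * e%:C ^+ k.
have uE k : u k.+1 = u' k.+1 + e%:C * u' k.
  by rewrite /u /u' cbinom_pascal exprS; ring.
have s1 : sums_to (fun k => u' (1 + k)%N) (l' - \sum_(k < 1) u' k).
  apply: (iffRL (sums_to_shift u' _ 1)).
  rewrite subrK.
  exact: h'.
have := sums_toD s1 (sums_toZ (a := e%:C) h') => s2.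
have s3 : sums_to (fun k => u (1 + k)%N) (l - \sum_(k < 1) u k).
  apply: (iffRL (sums_to_shift u _ 1)).
  rewrite subrK.
  exact: h.
have := sums_to_unique s3 (sums_to_ext _ s2) => E.
have {}E : l - \sum_(k < 1) u k = l' - \sum_(k < 1) u' k + e%:C * l'.
  by apply: E => k; rewrite add1n uE.
move: E; rewrite !big_ord1 /u /u' !cbinom0 expr0 mulr1 => E.
by rewrite -[l](subrK 1) E; ring.
Qed.

(** Since [(1 + e) B' = w B], the product of the sum [B] of the series with
    [(1 + e) ^ (- w)] has derivative 0 on [`]-1, 1[]; it is therefore equal to
    its value 1 at 0. *)
Theorem binomial_series w e : `|e| < 1 ->
  sums_to (fun k => cbinom w k * e%:C ^+ k) (cpow (1 + e) w).
Proof.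
move=> e1.
pose S v t := xget (0 : C) [set l | sums_to (fun k => cbinom v k * t%:C ^+ k) l].
have hS v t : `|t| < 1 -> sums_to (fun k => cbinom v k * t%:C ^+ k) (S v t).
  move=> t1; have [l hl] := cbinom_sums v t1.
  exact: (@xgetPex _ 0 [set l | sums_to (fun k => cbinom v k * t%:C ^+ k) l]
    (ex_intro _ l hl)).
have SE v t u : `|t| < 1 -> binom_part u v t = complex.Re (u * S v t).
  by move=> t1; apply: binom_partE; exact: hS.
have SP t : `|t| < 1 -> S w t = (1 + t%:C) * S (w - 1) t.
  by move=> t1; apply: binom_sums_pascal; exact: hS.
pose pR t := complex.Re (cpow (1 + t) (- w)).
pose pI t := complex.Im (cpow (1 + t) (- w)).
pose bR t := binom_part 1 w t.
pose bI t := binom_part (- 'i%C) w t.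
have ReN (z : C) : complex.Re (- 'i%C * z) = complex.Im z.
  by case: z => a b /=; rewrite oppr0 mul0r sub0r mulN1r opprK.
have dR t : `|t| < 1 -> is_derive t (1:R) (fun t => bR t * pR t - bI t * pI t) 0.
  move=> t1; have t1' : -1 < t by move: t1; rewrite ltr_norml => /andP[].
  apply: derive_eq_fun.
    apply: deriveB_fun; apply: deriveM_fun.
    - exact: derive_binom_part.
    - exact: derive_cpow_Re.
    - exact: derive_binom_part.
    - exact: derive_cpow_Im.
  rewrite /bR /bI /pR /pI !SE// SP// mul1r -mulrA !ReN.
  case: (S (w - 1) t) (cpow _ _) => a b [c d]; case: (w) => f g /=.
  by field; rewrite gt_eqF; lra.
have dI t : `|t| < 1 -> is_derive t (1:R) (fun t => bR t * pI t + bI t * pR t) 0.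
  move=> t1; have t1' : -1 < t by move: t1; rewrite ltr_norml => /andP[].
  apply: derive_eq_fun.
    apply: deriveD_fun; apply: deriveM_fun.
    - exact: derive_binom_part.
    - exact: derive_cpow_Im.
    - exact: derive_binom_part.
    - exact: derive_cpow_Re.
  rewrite /bR /bI /pR /pI !SE// SP// mul1r -mulrA !ReN.
  case: (S (w - 1) t) (cpow _ _) => a b [c d]; case: (w) => f g /=.
  by field; rewrite gt_eqF; lra.
have prodE t : `|t| < 1 -> S w t * cpow (1 + t) (- w) =
    (bR t * pR t - bI t * pI t) +i* (bR t * pI t + bI t * pR t).
  move=> t1; rewrite /bR /bI !SE// ReN mul1r /pR /pI.
  by case: (S w t) (cpow _ _) => a b [].
have n0 : `|0 : R| < 1 by rewrite normr0.
have S0 : S w 0 = 1.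
  apply: (sums_to_unique (hS w 0 n0)).
  have := @sums_to_finite R (fun k => cbinom w k * 0%:C ^+ k) 1.
  rewrite big_ord1 expr0 cbinom0 mulr1; apply => -[//|k] _.
  by rewrite expr0n mulr0.
have c0 v : cpow (1 + 0) v = 1 :> C.
  by rewrite addr0 cpowE ln1 mulr0 cexp0.
have E : S w e * cpow (1 + e) (- w) = 1.
  rewrite prodE// (zero_derive_const dR)// (zero_derive_const dI)//.
  by rewrite -prodE// S0 c0 mulr1.
suff -> : cpow (1 + e) w = S w e by exact: hS.
have E2 : cpow (1 + e) w * cpow (1 + e) (- w) = 1.
  by rewrite -cpowD subrr cpowE mul0r cexp0.
by apply: (mulIf (cpow_neq0 (1 + e) (- w))); rewrite E E2.
Qed.

End BinomialSeries.

(** * Remainders of the binomial series as functions of the exponent *)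

Section BinomialRemainder.
Variable R : realType.
Local Notation C := R[i].
Implicit Types (p s : C) (r t q e b : R).

Definition sum_of (u : nat -> C) : C := xget 0 [set l | sums_to u l].

Lemma sum_ofP u l : sums_to u l -> sums_to u (sum_of u).
Proof.
move=> ul; exact: (@xgetPex _ 0 [set l | sums_to u l] (ex_intro _ l ul)).
Qed.

Definition binom_remainder K e s : C :=
  cpow (1 + e) (- s) - \sum_(k < K) cbinom (- s) k * e%:C ^+ k.

(** The remainder is the part [k >= K] of the binomial series.  Factoring
    [e ^ K] out leaves a series that is dominated uniformly for [|e| <= t]. *)
Lemma expands_binom_remainder p r t K : 0 < r -> 0 < t < 1 -> exists2 M, 0 <= M &
  forall e, `|e| <= t ->
  exists c, expands (binom_remainder K e) p r (M * `|e| ^+ K) c.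
Proof.
move=> r0 /andP[t0 t1]; have rho0 : 0 <= normc p + r by rewrite addr_ge0 ?normc_ge0 ?ltW.
have [|A [q [q01 hA]]] := rising_binom_geo rho0 (_ : 0 <= t < 1).
  by rewrite (ltW t0).
have A0 : 0 <= A.
  have := hA 0%N; rewrite !expr0 !mulr1; apply: le_trans.
  exact: rising_binom_ge0.
have /andP[q0 q1] := q01.
exists (A / t ^+ K / (1 - q)).
  by rewrite !divr_ge0 ?exprn_ge0 ?(ltW t0)// subr_ge0 ltW.
move=> e et.
have e0 := normr_ge0 e.
have /choice[d hd] : forall n, exists d,
    expands (fun s => cbinom (- s) (K + n) * e%:C ^+ (K + n)) p r
      (`|e| ^+ K * (A / t ^+ K) * q ^+ n) d.
  move=> n; have [d hd] := @expands_cbinomN R p r (K + n) r0.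
  eexists; apply: expands_mono (expandsM r0 hd (expands_cst _ p (ltW r0))).
  rewrite normcX normc_real [X in _ * X]exprD mulrCA -mulrA ler_wpM2l ?exprn_ge0//.
  have tK : 0 < t ^+ K by rewrite exprn_gt0.
  rewrite [leRHS]mulrAC ler_pdivlMr// -mulrA.
  apply: (@le_trans _ _ (rising_binom (normc p + r) (K + n) * t ^+ (K + n))).
    rewrite exprD ler_wpM2l ?rising_binom_ge0// mulrC ler_wpM2l ?(ltW tK)//.
    by rewrite lerXn2r ?nnegrE ?(ltW t0).
  apply: le_trans (hA _) _; rewrite ler_wpM2l//.
  by rewrite exprD ler_piMl ?exprn_ge0 ?exprn_ile1 ?(ltW q1).
have [s _|c hc] := expands_series r0 q01 hd (g := binom_remainder K e).
  have e1 : `|e| < 1 by exact: le_lt_trans t1.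
  apply: (iffRL (sums_to_shift (fun k => cbinom (- s) k * e%:C ^+ k) _ K)).
  rewrite /binom_remainder subrK; exact: binomial_series.
exists c; apply: expands_mono hc.
by rewrite -[leLHS]mulrA [leLHS]mulrC.
Qed.

(** Compared with the terms of [sum_n w n * (b n * (1 + e n)) ^ (- s)], the
    remainders gain a factor [|e n| ^ K]; when [e n] decays, their series
    therefore converges, and is analytic, further to the left. *)
Lemma analytic_remainder_series (w : nat -> C) (b e : nat -> R) p r t K A q :
  0 < r -> 0 < t < 1 -> 0 <= q < 1 ->
  (forall n, 1 <= b n) -> (forall n, `|e n| <= t) ->
  (forall n, normc (w n) * expR ((r - complex.Re p) * ln (b n)) * `|e n| ^+ K
     <= A * q ^+ n) ->
  let f n s := w n * (cpow (b n) (- s) * binom_remainder K (e n) s) in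
  analytic_at (fun s => sum_of (f ^~ s)) p /\
  forall s, normc (s - p) < r -> sums_to (f ^~ s) (sum_of (f ^~ s)).
Proof.
move=> r0 t01 q01 b1 et hA f.
have [M M0 hM] := expands_binom_remainder p K r0 t01.
have /choice[c hc] : forall n, exists c, expands (f n) p r (M * A * q ^+ n) c.
  move=> n; have [c hc] := hM _ (et n).
  have b0 : 0 < b n by rewrite (lt_le_trans _ (b1 n)).
  eexists; apply: expands_mono (expandsM r0 (expands_cst (w n) p (ltW r0))
    (expandsM r0 (expands_cpow p b0 (ltW r0)) hc)).
  rewrite -mulrA; apply: le_trans (ler_wpM2l M0 (hA n)).
  rewrite ger0_norm ?ln_ge0// -[_ * r]mulrC -mulrDl [_ + r]addrC.
  by rewrite le_eqVlt; apply/orP; left; apply/eqP; ring.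
have S s : normc (s - p) < r -> sums_to (f ^~ s) (sum_of (f ^~ s)).
  move=> sr; have [|l] := @sums_to_geo_ex R (f ^~ s) (M * A) q q01.
    move=> n; exact: (expands_le_at r0 (hc n) sr).
  exact: sum_ofP.
split; last exact: S.
have [c' hc'] := expands_series r0 q01 hc S.
by exists r; do 2 eexists; split; [exact: r0|exact: hc'].
Qed.

End BinomialRemainder.

(** * Poles, residues and analytic continuation *)

Section Polar.
Variable R : realType.
Local Notation C := R[i].
Implicit Types (f g h F G : C -> C) (p s w : C) (r m : R) (c : nat -> C) (N : nat).

Definition punctured p (P : C -> Prop) : Prop :=
  exists2 r : R, 0 < r & forall s, 0 < normc (s - p) < r -> P s.

Lemma dnbhs_punctured (p : Num.NumField.sort R[i]) (P : set R[i]) :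
  (\forall s \near p^', P s) <-> punctured p P.
Proof.
have ballP s (e : R) : ball p e%:C s <-> normc (s - p) < e.
  rewrite -ball_normE /=.
  have -> : (`|p - s| < e%:C) = (`|(p : R[i]) - s| < e%:C) by [].
  by rewrite normr_normc ltcR normcB.
split.
  move=> /nbhs_ballP [e /= e0 he].
  have [e1 Ee] : exists e1, e = e1%:C by apply/complex_realP; rewrite realE (ltW e0).
  have {}e0 : 0 < e1 by move: e0; rewrite Ee ltcR.
  exists e1 => // s /andP[s0 s1]; apply: he; first by rewrite Ee; apply/ballP.
  by apply/eqP => E; rewrite E subrr normc0 ltxx in s0.
move=> [r r0 h]; apply/nbhs_ballP; exists r%:C.
  by have : (0 : R[i]) < r%:C by rewrite ltcR.
move=> s /ballP sr /eqP sp.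
by apply: h; rewrite sr andbT normc_gt0 subr_eq0; exact/eqP.
Qed.

Lemma puncturedS2 p (P Q S : C -> Prop) :
  (forall s, s != p -> P s -> Q s -> S s) ->
  punctured p P -> punctured p Q -> punctured p S.
Proof.
move=> PQ [r r0 hP] [r' r'0 hQ]; exists (Num.min r r'); first by rewrite lt_min r0.
move=> s; rewrite lt_min => /and3P[s0 sr sr'].
apply: PQ; first by rewrite -subr_eq0 -normc_gt0.
  by apply: hP; rewrite s0.
by apply: hQ; rewrite s0.
Qed.

Lemma puncturedS p (P Q : C -> Prop) : (forall s, P s -> Q s) ->
  punctured p P -> punctured p Q.
Proof. by move=> PQ [r r0 h]; exists r => // s sr; apply/PQ/h. Qed.

(** A pole of order at most [N], represented by an analytic numerator: closure
    under sums and products then follows from that of analytic functions. *)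
Definition polar N G p : Prop := exists2 g, analytic_at g p &
  punctured p (fun s => G s = g s / (s - p) ^+ N).

Lemma polar_le N N' G p : (N <= N')%N -> polar N G p -> polar N' G p.
Proof.
move=> NN [g ag hg]; exists (fun s => (s - p) ^+ (N' - N) * g s).
  apply: (analyticM _ ag); apply: analyticX.
  by apply: analyticB; [exact: analytic_id|exact: analytic_cst].
case: hg => r r0 h; exists r => // s sr.
have /andP[s0 _] := sr; rewrite normc_gt0 in s0.
have y0 : (s - p) ^+ (N' - N) != 0 by rewrite expf_neq0.
have -> : (s - p) ^+ N' = (s - p) ^+ (N' - N) * (s - p) ^+ N.
  by rewrite -exprD subnK.
by rewrite h// -mulf_div divff// mul1r.
Qed.

Lemma analytic_polar g p : analytic_at g p -> polar 0 g p.
Proof.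
by move=> ag; exists g => //; exists 1 => // s _; rewrite expr0 divr1.
Qed.

Lemma analytic_polar_le N g p : analytic_at g p -> polar N g p.
Proof. by move=> /analytic_polar; exact: polar_le. Qed.

Lemma polarD N G H p : polar N G p -> polar N H p ->
  polar N (fun s => G s + H s) p.
Proof.
move=> [g ag hg] [h ah hh]; exists (fun s => g s + h s); first exact: analyticD.
by apply: puncturedS2 hg hh => s _ -> ->; rewrite mulrDl.
Qed.

Lemma polarM N G g p : analytic_at g p -> polar N G p ->
  polar N (fun s => g s * G s) p.
Proof.
move=> ag [h ah hh]; exists (fun s => g s * h s); first exact: analyticM.
by apply: puncturedS hh => s ->; rewrite mulrA.
Qed.

Lemma polar_ext N G H p : (forall s, G s = H s) -> polar N G p -> polar N H p.
Proof. by move=> /funext ->. Qed.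

Lemma polar_near N G H p : punctured p (fun s => H s = G s) -> polar N G p ->
  polar N H p.
Proof.
move=> HG [g ag hg]; exists g => //.
by apply: puncturedS2 HG hg => s _ ->.
Qed.

Lemma polarB N G H p : polar N G p -> polar N H p ->
  polar N (fun s => G s - H s) p.
Proof.
move=> pG /(polarM (analytic_cst (-1) p)) pH.
by apply: polar_ext (polarD pG pH) => s; rewrite mulN1r.
Qed.

Lemma polar_sum N (I : Type) (l : seq I) (F : I -> C -> C) p :
  (forall i, polar N (F i) p) -> polar N (fun s => \sum_(i <- l) F i s) p.
Proof.
move=> hF; elim: l => [|i l IH].
  apply: polar_ext (analytic_polar_le N (analytic_cst 0 p)) => s.
  by rewrite big_nil.
by apply: polar_ext (polarD (hF i) IH) => s; rewrite big_cons.
Qed.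

Lemma polar_shift N G a p : polar N G (p + a) ->
  polar N (fun s => G (s + a)) p.
Proof.
move=> [g ag [r r0 h]]; exists (fun s => g (s + a)).
  exact: analytic_shift.
exists r => // s sr; rewrite h opprD addrACA subrr addr0//.
Qed.

Lemma sums_to_bounded (u : nat -> C) l : sums_to u l ->
  exists A : R, forall n, normc (u n) <= A.
Proof.
move=> /sums_toP /(_ 1 ltr01) [M _ hM].
exists (\sum_(i < M) normc (u i) + 2) => n.
have [nM|Mn] := ltnP n M.
  rewrite (bigD1 (Ordinal nM))//= -addrA lerDl addr_ge0// sumr_ge0// => i _.
  exact: normc_ge0.
have -> : u n = (\sum_(k < n.+1) u k - l) + (l - \sum_(k < n) u k).
  by rewrite addrA subrK big_ord_recr /= addrAC subrr add0r.
apply: le_trans (normcD _ _) _; rewrite ler_wpDl ?sumr_ge0// => [i _|].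
  exact: normc_ge0.
have -> : 2 = 1 + 1 :> R by [].
rewrite lerD//; last exact: hM.
rewrite normcB; apply: hM; exact: leq_trans Mn _.
Qed.

(** Multiplication by [(s - p) ^ N] turns the Laurent series into a power
    series.  Its terms are bounded at one point of the punctured disc, which
    gives the l1 bound at half the distance. *)
Lemma laurent_series f p b N :
  punctured p (fun s => sums_to (fun n : nat => b n * (s - p) ^ (n%:Z - N%:Z)) (f s)) ->
  exists g r m, [/\ 0 < r, expands g p r m b &
    punctured p (fun s => f s = g s / (s - p) ^+ N)].
Proof.
move=> [r r0 h].
have XE (w : C) (n : nat) : w != 0 -> w ^ (n%:Z - N%:Z) = w ^+ n / w ^+ N.
  by move=> w0; rewrite expfzDr// -exprnN.
pose rho := r / 2.
have rho0 : 0 < rho by rewrite divr_gt0.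
have rc : rho%:C != 0 by rewrite -normc_gt0 normc_real normr_gt0 gt_eqF.
have [|A hA] := @sums_to_bounded (fun n : nat => b n * rho%:C ^ (n%:Z - N%:Z))
  (f (p + rho%:C)).
  have := h (p + rho%:C); rewrite [p + _ - p]addrAC subrr add0r; apply.
  rewrite normc_real gtr0_norm// rho0 /rho; lra.
have hB n : normc (b n) * rho ^+ n <= A * rho ^+ N.
  have := hA n; rewrite XE// mulrA normcM normcV ler_pdivrMr ?normc_gt0 ?expf_neq0//.
  by rewrite normcM !normcX normc_real gtr0_norm.
have B0 : 0 <= A * rho ^+ N.
  by apply: le_trans (hB 0%N); rewrite expr0 mulr1 normc_ge0.
pose g s := if s == p then b 0%N else (s - p) ^+ N * f s.
exists g, (rho / 2), (A * rho ^+ N * 2); split; first by rewrite divr_gt0.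
- split=> [n|w wr].
    have half : 0 <= (2^-1 : R) < 1 by rewrite invr_ge0 ler0n invf_lt1// ltr1n.
    have h2 : (1 - 2^-1)^-1 = 2 :> R by field.
    rewrite -[X in _ <= _ * X]h2.
    apply: le_trans (ler_wpM2l B0 (geometric_partial n half)).
    rewrite mulr_sumr; apply: ler_sum => k _.
    by rewrite exprMn [leLHS]mulrA ler_wpM2r ?exprn_ge0 ?invr_ge0.
  rewrite /g addrC addrK.
  have [->|w0] := eqVneq w 0.
    rewrite add0r eqxx [X in sums_to _ X](_ : _ = \sum_(k < 1) b k * 0 ^+ k).
      by apply: sums_to_finite => -[|k]//= _; rewrite expr0n mulr0.
    by rewrite big_ord1 expr0 mulr1.
  rewrite -subr_eq0 addrK (negbTE w0).
  have := h (w + p); rewrite addrK => hw.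
  have {}hw := sums_toZ (a := w ^+ N) (hw _).
  apply: (sums_to_ext _ (hw _)) => [k|].
    by rewrite XE// mulrCA; congr (_ * _); rewrite mulrC divfK ?expf_neq0.
  by rewrite normc_gt0 w0 (lt_trans wr)// /rho; lra.
- exists r => // s /andP[s0 _]; rewrite /g.
  rewrite normc_gt0 in s0; rewrite -subr_eq0 (negbTE s0).
  by rewrite mulrC mulKf ?expf_neq0.
Qed.

Lemma laurent_polar f p (c : int -> C) : laurent_expansion f p c -> exists N, polar N f p.
Proof.
move=> [N _ h]; exists N.
have [g [r [m [r0 eg hg]]]] := @laurent_series f p (fun n => c (n%:Z - N%:Z)) N (iffLR (dnbhs_punctured _ _) h).
by exists g; [exists r, m; eexists; split; [exact: r0|exact: eg]|exact: hg].
Qed.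

Lemma polar_laurent f g p r m c : 0 < r -> expands g p r m c ->
  punctured p (fun s => f s = g s / (s - p)) ->
  laurent_expansion f p
    (fun k : int => if - (1%N)%:Z <= k then c (absz (k + 1)) else 0).
Proof.
move=> r0 eg [r' r'0 h]; exists 1%N => [k|].
  by rewrite ltNge => /negbTE ->.
apply/dnbhs_punctured; exists (Num.min r r'); first by rewrite lt_min r0.
move=> s; rewrite lt_min => /and3P[s0 sr sr'].
rewrite h ?s0//; rewrite normc_gt0 in s0.
rewrite mulrC; have hs := sums_toZ (a := (s - p)^-1) (expands_sums_at eg sr).
apply: (sums_to_ext _ hs) => n.
rewrite lerBrDl subrr lez_nat /= subrK absz_nat.
by rewrite expfzDr// mulrCA; congr (_ * _); rewrite mulrC.
Qed.

Lemma expands_mul_expr g p r m c M : 0 < r -> expands g p r m c ->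
  expands (fun s => (s - p) ^+ M * g s) p r (r ^+ M * m)
    (fun k => if (k < M)%N then 0 else c (k - M)%N).
Proof.
move=> r0 [hm hs]; split=> [n|w wr].
  have [nM|Mn] := leqP n M.
    rewrite big1 => [|i _]; last by rewrite (leq_trans (ltn_ord i) nM) normc0 mul0r.
    by rewrite mulr_ge0 ?exprn_ge0 ?(ltW r0)// (le_trans _ (hm 0%N))// big_ord0.
  rewrite -(subnKC (ltnW Mn)) big_split_ord /= big1 ?add0r => [|i _]; last first.
    by rewrite (ltn_ord i) normc0 mul0r.
  apply: le_trans (ler_wpM2l (exprn_ge0 M (ltW r0)) (hm (n - M)%N)).
  rewrite mulr_sumr; apply: ler_sum => i _.
  by rewrite ltnNge leq_addr /= addKn exprD mulrCA.
rewrite [p + w - p]addrAC subrr add0r.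
pose u k := (if (k < M)%N then 0 else c (k - M)%N) * w ^+ k.
have u0 : \sum_(k < M) u k = 0.
  by rewrite big1 // => i _; rewrite /u (ltn_ord i) mul0r.
have -> : w ^+ M * g (p + w) = w ^+ M * g (p + w) + \sum_(k < M) u k.
  by rewrite u0 addr0.
apply: (iffLR (sums_to_shift u _ M)).
apply: (sums_to_ext _ (sums_toZ (a := w ^+ M) (hs _ wr))) => k.
by rewrite /u ltnNge leq_addr /= addKn exprD mulrCA.
Qed.

Lemma expands_coef_unique g h p r r' m m' c c' : 0 < r -> 0 < r' ->
  expands g p r m c -> expands h p r' m' c' ->
  punctured p (fun s => g s = h s) -> forall k, c k = c' k.
Proof.
move=> r0 r'0 eg eh [d d0 gh] k; pose r1 := Num.min r r'.
have r10 : 0 < r1 by rewrite lt_min r0.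
have eg1 : expands g p r1 m c.
  by apply: expands_shrink eg; rewrite ltW//= ge_min lexx.
have eh1 : expands h p r1 m' c'.
  by apply: expands_shrink eh; rewrite ltW//= ge_min lexx orbT.
have eN := expandsZ (-1) (ltW r10) eh1.
apply/eqP; rewrite -subr_eq0 -mulN1r; apply/eqP.
apply: (expands_zero_coefs r10 (expandsD eg1 eN (ltW r10))) => e e0.
have e1 : 0 < Num.min e d / 2 by rewrite divr_gt0// lt_min e0.
have E : normc (p + (Num.min e d / 2)%:C - p) = Num.min e d / 2.
  by rewrite addrC addKr normc_real gtr0_norm.
have lt2 : Num.min e d / 2 < Num.min e d by lra.
move: (lt2); rewrite lt_min => /andP[le ld].
exists (p + (Num.min e d / 2)%:C); first by rewrite E e1.
by rewrite gh ?mulN1r ?subrr// E e1.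
Qed.

(** The coefficients of any Laurent expansion of [f], shifted by the power of
    [s - p] that clears its poles, are those of a power of [s - p] times [g],
    so the one of index -1 is the constant coefficient of [g]. *)
Lemma residue_simple f g p : analytic_at g p ->
  punctured p (fun s => f s = g s / (s - p)) -> residue f p = g p.
Proof.
move=> [r [m [b [r0 eg]]]] hf.
have L := polar_laurent r0 eg hf.
have gb := expands_val r0 eg.
rewrite /residue; set A := [set v | _].
have [c [N cN /dnbhs_punctured hc] <-] : A (xget 0 A).
  by apply: xgetPex; exists (b 0%N); eexists; first exact: L.
have [g' [r' [m' [r'0 eg' hg']]]] := @laurent_series f p (fun n => c (n%:Z - N%:Z)) N hc.
(* for [N = 0] there is no term of index -1, and [g] vanishes at [p] *)
case: N => [|N] in cN hc eg' hg' *.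
  rewrite cN// gb.
  have := expands_coef_unique r0 r'0 eg (expands_mul_expr 1 r'0 eg') _ 0 => -> //.
  apply: puncturedS2 hf hg' => s sp -> /eqP.
  rewrite expr0 divr1 expr1 => /eqP <-.
  by rewrite mulrC divfK// subr_eq0.
have := expands_coef_unique r'0 r0 eg' (expands_mul_expr N r0 eg) _ N.
rewrite ltnn subnn -gb => <-.
  by rewrite -[N.+1]addn1 PoszD opprD addrA subrr sub0r.
apply: puncturedS2 hf hg' => s sp -> /eqP E.
have s0 : s - p != 0 by rewrite subr_eq0.
have sN : (s - p) ^+ N != 0 by rewrite expf_neq0.
move: E; rewrite exprS.
have -> : g' s / ((s - p) * (s - p) ^+ N) = (g' s / (s - p) ^+ N) / (s - p).
  by rewrite invfM mulrA mulrAC.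
move/eqP/(mulIf (invr_neq0 s0)) => ->.
by rewrite mulrC divfK.
Qed.

(** Let [sup S] be the supremum of the abscissas around which [G] is not zero.
    The points to its right make zeros of [G] accumulate at it, so [G] vanishes
    around it after all.  Only zeros accumulating at the centre of an
    expansion are needed, hence no expansion has to be recentred. *)
Lemma identity_on_ray G p (L : R) :
  (forall sigma, complex.Re p <= sigma ->
     exists N, polar N G (sigma +i* complex.Im p)) ->
  (forall s, L < complex.Re s -> G s = 0) ->
  punctured p (fun s => G s = 0).
Proof.
move=> hG hL; pose P t := punctured (t +i* complex.Im p) (fun s => G s = 0).
suff : P (complex.Re p) by rewrite /P; case: (p).
apply: contrapT => nP.
pose S := [set t | complex.Re p <= t /\ ~ P t].
have Sp : S (complex.Re p) by split.
have Pgt t : L < t -> P t.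
  move=> Lt; exists (t - L) => [|s /andP[_ sr]]; first by rewrite subr_gt0.
  apply: hL; have := le_lt_trans (normc_Re _) sr.
  by case: s {sr} => a b /=; rewrite ltr_norml => /andP[+ _]; lra.
have supS : has_sup S.
  split; first by exists (complex.Re p).
  by exists L => t [_ nt]; rewrite leNgt; apply/negP => /Pgt.
have pS : complex.Re p <= sup S by apply: sup_ubound => //; case: supS.
have Pgt' t : sup S < t -> P t.
  move=> St; apply: contrapT => nt; suff : t <= sup S by rewrite leNgt St.
  apply: sup_ubound; first by case: supS.
  by split=> //; apply: le_trans pS (ltW St).
have [N [g ag [r r0 hr]]] := hG _ pS.
set q := (sup S +i* _) in ag hr.
have [|d d0 hd] := analytic_isolated_zeros ag.
  move=> e e0; pose e1 := Num.min e r.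
  have e10 : 0 < e1 by rewrite lt_min e0.
  have [|d d0 hd] := Pgt' (sup S + e1 / 2); first by rewrite ltrDl divr_gt0.
  pose e2 := Num.min d (e1 / 2).
  have e20 : 0 < e2 by rewrite lt_min d0 divr_gt0.
  have e2d : e2 <= d by rewrite ge_min lexx.
  have e2e : e2 <= e1 / 2 by rewrite ge_min lexx orbT.
  pose s := q + (e1 / 2 + e2 / 2)%:C.
  have sq : normc (s - q) = e1 / 2 + e2 / 2.
    by rewrite /s addrC addKr normc_real gtr0_norm// addr_gt0// divr_gt0.
  have sq0 : 0 < normc (s - q) < e1 by rewrite sq; apply/andP; split; lra.
  have /andP[sq1 sq2] := sq0; move: (sq2); rewrite lt_min => /andP[se sr].
  exists s; first by rewrite sq1.
  have := hr s; rewrite sq1 sr => /(_ isT).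
  rewrite hd; last first.
    have -> : s - ((sup S + e1 / 2) +i* complex.Im p) = (e2 / 2)%:C.
      by apply/eqP; rewrite eq_complex /s /q /=; apply/andP; split; apply/eqP; ring.
    by rewrite normc_real gtr0_norm ?divr_gt0//; apply/andP; split; lra.
  move/esym/eqP; rewrite mulf_eq0 invr_eq0 expf_eq0.
  by rewrite normc_gt0 in sq1; rewrite (negbTE sq1) andbF orbF => /eqP.
pose e := Num.min r d.
have e0 : 0 < e by rewrite lt_min r0.
have Gq s : 0 < normc (s - q) < e -> G s = 0.
  rewrite lt_min => /and3P[s0 sr sd].
  by rewrite hr ?s0// hd// mul0r.
have [t [tp nt] te] := sup_adherent e0 supS.
have tS : t <= sup S by exact: (sup_ubound (proj2 supS) (conj tp nt)).
apply: nt.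
have [->|tn] := eqVneq t (sup S); first by exists e.
have tlt : t < sup S by rewrite lt_neqAle tn.
exists (Num.min (sup S - t) (t - (sup S - e))) => [|s].
  by rewrite lt_min subr_gt0 tlt subr_gt0.
rewrite lt_min => /and3P[s0 s1 s2]; apply: Gq; apply/andP; split.
  rewrite normc_gt0; apply/eqP => E; move: s1.
  have -> : s - (t +i* complex.Im p) = (sup S - t)%:C + (s - q).
    by case: (s) => a b; apply/eqP; rewrite eq_complex /q /=; apply/andP; split; apply/eqP; ring.
  by rewrite E addr0 normc_real gtr0_norm ?subr_gt0// ltxx.
have -> : s - q = (s - (t +i* complex.Im p)) + (t - sup S)%:C.
  by case: (s) => a b; apply/eqP; rewrite eq_complex /q /=; apply/andP; split; apply/eqP; ring.
apply: le_lt_trans (normcD _ _) _.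
rewrite normc_real ltr0_norm ?subr_lt0// opprB; lra.
Qed.

End Polar.

(** * Linear recurrences with simple roots *)

Section Recurrences.
Variable F : fieldType.
Implicit Types (Q : {poly F}) (u : nat -> F).

(** The [m]-th term of [Q(nabla) u], where [nabla] is the shift. *)
Definition shift_act Q u (m : nat) : F := \sum_(i < size Q) Q`_i * u (m + i)%N.

Lemma shift_act_widen Q u m N : (size Q <= N)%N ->
  shift_act Q u m = \sum_(i < N) Q`_i * u (m + i)%N.
Proof.
move=> QN; rewrite -(subnKC QN) big_split_ord /= [X in _ + X]big1 ?addr0// => i _.
by rewrite nth_default ?mul0r// leq_addr.
Qed.

Lemma shift_act_mulXsubC Q u b m :
  shift_act (('X - b%:P) * Q) u m =
  shift_act Q (fun k => u k.+1 - b * u k) m.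
Proof.
rewrite (@shift_act_widen (('X - b%:P) * Q) _ _ (size Q).+1); last first.
  by rewrite (leq_trans (size_polyMleq _ _))// size_XsubC.
rewrite /shift_act; under eq_bigr do rewrite mulrBl coefB coefXM coefCM mulrBl.
rewrite sumrB big_ord_recl /= mul0r add0r.
rewrite [X in _ - X]big_ord_recr /= [Q`_(size Q)]nth_default// mulr0 mul0r addr0.
rewrite -sumrB; apply: eq_bigr => i _.
by rewrite /bump /= addnS mulrBr mulrCA mulrA.
Qed.

(** Induction on the roots: [nabla u - b u] is a combination of powers of the
    other roots.  As [b] is none of them, dividing the coefficients by [x - b]
    solves this first-order recurrence up to a multiple of [b ^ m]. *)
Lemma power_sum_of_recurrence (s : seq F) u : uniq s ->
  (forall m, shift_act (\prod_(b <- s) ('X - b%:P)) u m = 0) ->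
  exists c : F -> F, forall m, u m = \sum_(b <- s) c b * b ^+ m.
Proof.
elim: s u => [|b s IH] u /=.
  move=> _ h; exists (fun=> 0) => m; rewrite big_nil.
  by have := h m; rewrite big_nil /shift_act size_poly1 big_ord1 coef1 mul1r addn0.
move=> /andP[bs us] h.
have [m|c hc] := IH (fun k => u k.+1 - b * u k) us.
  by have := h m; rewrite big_cons shift_act_mulXsubC.
pose v m := u m - \sum_(x <- s) c x / (x - b) * x ^+ m.
have vS m : v m.+1 = b * v m.
  have E : \sum_(x <- s) c x / (x - b) * x ^+ m.+1 =
      b * (\sum_(x <- s) c x / (x - b) * x ^+ m) + (u m.+1 - b * u m).
    rewrite hc mulr_sumr -big_split /=; apply: eq_big_seq => x xs.
    have xb : x - b != 0.
      by rewrite subr_eq0; apply: contraNneq bs => <-.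
    by rewrite exprS; field.
  by rewrite /v E; ring.
have vE m : v m = v 0%N * b ^+ m.
  elim: m => [|m IHm]; first by rewrite expr0 mulr1.
  by rewrite vS IHm exprS mulrCA.
exists (fun x => if x == b then v 0%N else c x / (x - b)) => m.
rewrite big_cons eqxx -vE -[LHS](subrK (\sum_(x <- s) c x / (x - b) * x ^+ m)).
congr (_ + _); apply: eq_big_seq => x xs.
by case: eqP => // xb; rewrite -xb xs in bs.
Qed.

(** The inner sums are [(x ^ i - y ^ i) / (x - y)], so the whole is
    [(Q(x) - Q(y)) / (x - y)]. *)
Lemma divided_difference Q (x y : F) : x != y -> root Q x -> root Q y ->
  \sum_(i < size Q) Q`_i * \sum_(k < i) x ^+ k * y ^+ (i.-1 - k) = 0.
Proof.
move=> xy Qx Qy; have xy0 : y - x != 0 by rewrite subr_eq0 eq_sym.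
apply: (mulfI xy0); rewrite mulr0 mulr_sumr.
rewrite (eq_bigr (fun i : 'I_(size Q) => Q`_i * y ^+ i - Q`_i * x ^+ i)).
  by rewrite sumrB -!horner_coef (rootP Qx) (rootP Qy) subrr.
move=> i _; rewrite -mulrBr subrXX mulrCA; congr (_ * (_ * _)).
by apply: eq_bigr => k _; rewrite mulrC.
Qed.

End Recurrences.

(** * The coefficient of the dominant root *)

Section DominantRoot.
Variable R : realType.
Local Notation C := R[i].

Lemma map_int_rat_C (P : {poly int}) :
  map_poly (intr : int -> C) P =
  map_poly (ratr : rat -> C) (map_poly intr P).
Proof.
rewrite -map_poly_comp; apply: eq_map_poly => n /=.
by rewrite ratr_int.
Qed.

(** In characteristic 0 the derivative is nonzero of smaller degree, hence
    prime to an irreducible polynomial. *)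
Lemma irreducible_separable (P : {poly rat}) : irreducible_poly P ->
  separable_poly P.
Proof.
move=> Pirr; rewrite unlock irreducible_poly_coprime//.
have P0 := irredp_neq0 Pirr; have [P1 _] := Pirr.
apply/negP => dvd; have [dP|dP] := eqVneq P^`() 0; last first.
  by have := dvdp_leq dP dvd; rewrite leqNgt lt_size_deriv.
have := coef_deriv P (size P).-2.
rewrite dP coef0 => /esym/eqP; rewrite -mulr_natr mulf_eq0 pnatr_eq0 orbF.
have -> : (size P).-2.+1 = (size P).-1 by case: (size P) P1 => [|[]].
by rewrite -lead_coefE lead_coef_eq0 (negbTE P0).
Qed.

(** A Bezout relation over the rationals still holds over the complex numbers. *)
Lemma irreducible_no_common_root (P A : {poly rat}) (x : C) :
  irreducible_poly P -> A != 0 -> (size A < size P)%N ->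
  root (map_poly ratr P) x -> ~~ root (map_poly ratr A) x.
Proof.
move=> Pirr A0 sA Px; have : coprimep P A.
  rewrite irreducible_poly_coprime//; apply/negP => /dvdp_leq.
  by rewrite A0 leqNgt sA => /(_ isT).
rewrite -(coprimep_map (ratr : {rmorphism rat -> C})) => /coprimep_root.
by move=> /(_ _ Px).
Qed.

(** Let [A = sum_i p_i sum_(k < i) a_(i - k) X ^ k], where [P = sum_i p_i X ^ i].
    It is rational of degree [deg P - 1], with leading coefficient [a_1 <> 0],
    hence prime to the irreducible [P] and nonzero at [alpha].  Inserting
    [a_(m + 1) = sum_b c_b b ^ m] shows that [A(alpha)] is [c_alpha P'(alpha)]:
    every other root contributes a divided difference of [P] at two of its
    roots. *)
Lemma dominant_coefficient_neq0 (a : nat -> int) (P : {poly int}) (s : seq C)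
    (c : C -> C) (alpha : C) :
  P \is monic -> irreducible_poly (map_poly intr P : {poly rat}) -> a 1%N != 0 ->
  (forall b, b \in s -> root (map_poly intr P) b) ->
  (forall m, (a m.+1)%:~R = \sum_(b <- s) c b * b ^+ m) ->
  root (map_poly intr P) alpha -> c alpha != 0.
Proof.
move=> Pm Pirr a1 sP hu Pa; apply/eqP => c0.
set PQ := map_poly intr P in Pirr.
have sPQ : size PQ = size P by apply: size_map_poly_id0; rewrite (monicP Pm).
have sPC : size (map_poly (intr : int -> C) P) = size P.
  by apply: size_map_poly_id0; rewrite (monicP Pm) oner_neq0.
have P1 : (1 < size P)%N by rewrite -sPQ; case: Pirr.
pose A : {poly rat} := \poly_(k < (size P).-1)
  (\sum_(i < size P | (k < i)%N) (P`_i * a (i.-1 - k).+1)%:~R).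
have sA : (size A < size PQ)%N.
  by rewrite sPQ (leq_ltn_trans (size_poly _ _))//; case: (size P) P1.
have A0 : A != 0.
  apply/eqP => A0; have := congr1 (fun Q : {poly rat} => Q`_(size P).-2) A0.
  rewrite coef0 coef_poly ifT; last by case: (size P) P1 => [|[]].
  have n1 : ((size P).-1 < size P)%N by case: (size P) P1.
  rewrite (big_pred1 (Ordinal n1)) /= => [|i]; last first.
    rewrite /= -val_eqE /= eqn_leq; case: i => i /=; case: (size P) P1 => [|[|n]]//= _ iP.
    by rewrite (iP : (i <= n.+1)%N).
  rewrite -lead_coefE (monicP Pm) mul1r subnn => /eqP.
  by rewrite intr_eq0 (negbTE a1).
have := irreducible_no_common_root (x := alpha) Pirr A0 sA.
rewrite -map_int_rat_C => /(_ Pa) /negP; apply; apply/rootP.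
rewrite (horner_coef_wide (n := (size P).-1)); last first.
  by rewrite size_map_poly size_poly.
rewrite (eq_bigr (fun k : 'I_(size P).-1 => \sum_(i < size P | (k < i)%N)
   (P`_i)%:~R * (alpha ^+ k * (a (i.-1 - k).+1)%:~R))) => [|k _]; last first.
  rewrite coef_map coef_poly ltn_ord /= rmorph_sum mulr_suml.
  by apply: eq_bigr => i _; rewrite rmorph_int intrM -mulrA [_ * alpha ^+ _]mulrC.
rewrite (exchange_big_dep predT)//=.
rewrite (eq_bigr (fun i : 'I_(size P) => \sum_(b <- s) c b *
   ((map_poly intr P)`_i * \sum_(k < i) alpha ^+ k * b ^+ (i.-1 - k)))) => [|i _]; last first.
  have iP : (i <= (size P).-1)%N by case: i => i /=; case: (size P).
  rewrite -(big_ord_widen _ (fun k => (P`_i)%:~R *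
    (alpha ^+ k * (a (i.-1 - k).+1)%:~R)) iP).
  rewrite coef_map /= (eq_bigr (fun k : 'I_i => \sum_(b <- s)
    (P`_i)%:~R * (alpha ^+ k * (c b * b ^+ (i.-1 - k))))) => [|k _].
    rewrite exchange_big /=; apply: eq_bigr => b _.
    by rewrite !mulr_sumr; apply: eq_bigr => k _; ring.
  by rewrite hu !mulr_sumr.
rewrite exchange_big /= big_seq big1 // => b bs; rewrite -mulr_sumr.
have [->|ba] := eqVneq b alpha; first by rewrite c0 mul0r.
rewrite -sPC divided_difference ?mulr0// 1?eq_sym//; exact: sP.
Qed.

End DominantRoot.

(** * Power sums and the dominant form of the sequence *)

Section PowerSums.
Variable R : realType.
Local Notation C := R[i].
Implicit Types (l : seq (C * C)) (m k : nat).

Definition power_sum l m : C := \sum_(x <- l) x.1 * x.2 ^+ m.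

Lemma power_sum_bound l : all (fun x => normc x.2 < 1) l ->
  exists D rho : R, [/\ 0 <= D, 0 < rho < 1 &
    forall m, normc (power_sum l m) <= D * rho ^+ m].
Proof.
elim: l => [|x l IH] /=.
  move=> _; exists 0, 2^-1; split=> // [|m].
    by rewrite invr_gt0 ltr0n invf_lt1// ltr1n.
  by rewrite /power_sum big_nil normc0 mul0r.
move=> /andP[x1 /IH[D [rho [D0 /andP[r0 r1] h]]]].
exists (normc x.1 + D), (Num.max (normc x.2) rho); split.
- by rewrite addr_ge0 ?normc_ge0.
- by rewrite lt_max r0 orbT gt_max x1.
move=> m; rewrite /power_sum big_cons.
have M0 : 0 <= Num.max (normc x.2) rho by rewrite le_max normc_ge0.
apply: le_trans (normcD _ _) _; rewrite mulrDl lerD//.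
  rewrite normcM normcX ler_wpM2l ?normc_ge0// lerXn2r ?nnegrE ?normc_ge0//.
  by rewrite le_max lexx.
apply: le_trans (h m) _; rewrite ler_wpM2l// lerXn2r ?nnegrE ?(ltW r0)//.
by rewrite le_max lexx orbT.
Qed.

Lemma power_sum_exp l k : all (fun x => normc x.2 < 1) l ->
  exists2 l', all (fun x => normc x.2 <= 1) l' &
    forall m, power_sum l m ^+ k = power_sum l' m.
Proof.
move=> /allP l1; elim: k => [|k [l' /allP l'1 h]].
  exists [:: (1, 1)]; first by rewrite /= normc1 lexx.
  by move=> m; rewrite /power_sum big_seq1 /= expr0 expr1n mul1r.
exists [seq (x.1 * y.1, x.2 * y.2) | x <- l, y <- l'].
  apply/allP => _ /allpairsP[[x y] /= [xl yl ->]] /=.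
  rewrite normcM mulr_ile1 ?normc_ge0//; last exact: (l'1 _ yl).
  exact: (ltW (l1 _ xl)).
move=> m; rewrite exprS h /power_sum big_allpairs_dep mulr_suml; apply: eq_bigr => x _.
by rewrite mulr_sumr; apply: eq_bigr => y _ /=; rewrite exprMn mulrACA.
Qed.

Lemma power_sum_shift l N : all (fun x => normc x.2 < 1) l ->
  exists2 l', all (fun x => normc x.2 < 1) l' &
    forall m, power_sum l (N + m) = power_sum l' m.
Proof.
move=> /allP l1; exists [seq (x.1 * x.2 ^+ N, x.2) | x <- l].
  by apply/allP => _ /mapP[x xl ->] /=; exact: l1.
move=> m; rewrite /power_sum big_map; apply: eq_bigr => x _ /=.
by rewrite exprD mulrA.
Qed.

(** The quotients [u m / alpha ^ m] are nonnegative reals that tend to [c]. *)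
Lemma leading_coefficient_gt0 (u : nat -> R) (c : C) (alpha D rho : R) :
  (forall m, 0 <= u m) -> c != 0 -> 0 < alpha -> 0 < rho < 1 ->
  (forall m, normc ((u m / alpha ^+ m)%:C - c) <= D * rho ^+ m) ->
  exists2 c1 : R, 0 < c1 & c = c1%:C.
Proof.
move=> u0 c0 a0 /andP[/ltW r0 r1] h.
have r01 : 0 <= rho < 1 by rewrite r0.
case: c c0 h => x y c0 h.
have y0 : y = 0.
  apply/normr0_eq0/eqP; rewrite eq_le normr_ge0 andbT.
  apply: (@le_geometric_lim _ _ _ _ D r01) => m; rewrite add0r.
  apply: le_trans (h m); apply: le_trans _ (normc_Im _).
  by rewrite /= sub0r normrN.
have x0 : 0 <= x.
  rewrite -oppr_le0; apply: (@le_geometric_lim _ _ _ _ D r01) => m; rewrite add0r.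
  apply: le_trans (h m); apply: le_trans _ (normc_Re _).
  rewrite /=; apply: le_trans (ler_norm _).
  by rewrite lerBrDr addrC subrr divr_ge0 ?exprn_ge0// ltW.
exists x; last by rewrite y0.
rewrite lt_neqAle x0 andbT eq_sym; apply: contra c0 => /eqP ->.
by rewrite y0.
Qed.

(** Divide the expression of [a] as a combination of powers of the roots of
    [P] by its dominant term: the ratios of the other roots to [alpha] have
    modulus less than 1. *)
Theorem dominant_form (a : nat -> int) (P : {poly int}) (alpha : R) :
  P \is monic -> annihilates P a ->
  irreducible_poly (map_poly intr P : {poly rat}) -> dominant_root P alpha ->
  (forall n, (1 <= n)%N -> 0 < a n) ->
  exists (c : R) (e : nat -> R) (l : seq (C * C)),
    [/\ 0 < c, all (fun x => normc x.2 < 1) l,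
       (forall m, (e m)%:C = power_sum l m) &
       forall m, (a m.+1)%:~R = c * alpha ^+ m * (1 + e m)].
Proof.
move=> Pm Pa Pirr [Palpha alpha1 Pdom] apos.
have alpha0 : 0 < alpha by apply: lt_trans alpha1.
have alphaC : alpha%:C != 0 :> C.
  by rewrite -normc_gt0 normc_real normr_gt0 gt_eqF.
pose PC := map_poly (intr : int -> C) P.
have PCm : PC \is monic by exact: monic_map.
have [s sE] := closed_field_poly_normal PC.
rewrite (monicP PCm) scale1r in sE.
have us : uniq s.
  by rewrite -separable_prod_XsubC -sE /PC map_int_rat_C separable_map irreducible_separable.
have sP b : b \in s -> root PC b by rewrite sE root_prod_XsubC.
have als : alpha%:C \in s by rewrite -root_prod_XsubC -sE.
have sPC : size PC = size P by apply: size_map_poly_id0; rewrite (monicP Pm) oner_neq0.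
have [m|c hc] := @power_sum_of_recurrence _ s (fun m => (a m.+1)%:~R : C) us.
  rewrite -sE /shift_act sPC.
  have := congr1 (intr : int -> C) (Pa m.+1 isT); rewrite rmorph_sum /= mulr0z => E.
  by rewrite -[RHS]E; apply: eq_bigr => i _; rewrite coef_map /= intrM addSn.
have a1 : a 1%N != 0 by rewrite gt_eqF ?apos.
have c0 := dominant_coefficient_neq0 Pm Pirr a1 sP hc Palpha.
set c1 := c alpha%:C in c0.
pose l := [seq (c b / c1, b / alpha%:C) | b <- rem alpha%:C s].
have l1 : all (fun x => normc x.2 < 1) l.
  apply/allP => _ /mapP[b + ->] /=; rewrite mem_rem_uniq// inE => /andP[ba bs].
  rewrite normcM normcV normc_real gtr0_norm// ltr_pdivrMr// mul1r.
  exact: Pdom (sP _ bs) ba.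
have aE m : (a m.+1)%:~R = c1 * alpha%:C ^+ m * (1 + power_sum l m).
  rewrite hc (perm_big _ (perm_to_rem als)) big_cons /= mulrDr mulr1; congr (_ + _).
  rewrite /power_sum big_map mulr_sumr; apply: eq_bigr => b _ /=.
  by rewrite expr_div_n; field; rewrite c0 expf_neq0.
have [D [rho [D0 r01 hD]]] := power_sum_bound l1.
have aR m : ((a m.+1)%:~R : R)%:C = (a m.+1)%:~R by rewrite rmorph_int.
have aE' m : (((a m.+1)%:~R : R) / alpha ^+ m)%:C - c1 = c1 * power_sum l m.
  rewrite rmorphM fmorphV rmorphXn /= aR aE.
  by field; rewrite expf_neq0.
have [m||c2 c20 c2E] := @leading_coefficient_gt0 (fun m => (a m.+1)%:~R) c1 alpha
    (normc c1 * D) rho _ c0 alpha0 r01.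
- by rewrite ler0z ltW ?apos.
- by move=> m; rewrite aE' normcM -mulrA ler_wpM2l ?normc_ge0.
have ca0 m : c2 * alpha ^+ m != 0 by rewrite mulf_neq0 ?expf_neq0 ?gt_eqF.
exists c2, (fun m => (a m.+1)%:~R / (c2 * alpha ^+ m) - 1), l; split=> // m.
  have cC : c2%:C != 0 by rewrite -c2E.
  rewrite rmorphB rmorphM fmorphV rmorphM rmorphXn /= aR aE c2E.
  by field; rewrite cC expf_neq0.
by rewrite addrC subrK mulrC divfK.
Qed.

End PowerSums.

(** * Simple poles of power-like Dirichlet series *)

Section SimplePoles.
Variable R : realType.
Local Notation C := R[i].
Implicit Types (p q s z w : C) (k m : nat).

Lemma geometric_small (X rho : R) : 0 < rho < 1 -> exists K, X * rho ^+ K < 1.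
Proof.
move=> /andP[r0 r1]; apply: contrapT => h.
have : (1 : R) <= 0.
  apply: (@le_geometric_lim _ rho _ _ X); first by rewrite (ltW r0).
  move=> n; rewrite add0r leNgt; apply/negP => hn; apply: h; by exists n.
by rewrite ler10.
Qed.

Lemma cpow_exp (t : R) m w : 0 < t -> cpow (t ^+ m) w = cpow t w ^+ m.
Proof.
move=> t0; elim: m => [|m IH]; first by rewrite !expr0 cpowE ln1 mulr0 cexp0.
by rewrite !exprS cpowM ?exprn_gt0// IH.
Qed.

Lemma analytic_cbinomN p k : analytic_at (fun s => cbinom (- s) k) p.
Proof.
have [c hc] := expands_cbinomN p k (@ltr01 R).
by exists 1; do 2 eexists; split; [exact: ltr01|exact: hc].
Qed.

(** At a zero [q] of the denominator its derivative is
    [w * ln alpha * alpha ^ (- q)], which is not zero. *)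
Lemma geometric_polar (alpha : R) w q : 1 < alpha ->
  polar 1 (fun s => (1 - w * cpow alpha (- s))^-1) q.
Proof.
move=> a1; have a0 : 0 < alpha by apply: lt_trans a1.
have E := expandsD (expands_cst 1 q (@ler01 R))
   (expandsZ (- w) (@ler01 R) (expands_cpow q a0 (@ler01 R))) (@ler01 R).
have gE s : normc (s - q) < 1 ->
    1 + - w * cpow alpha (- s) = 1 - w * cpow alpha (- s) by rewrite mulNr.
have {gE}E := expands_ext gE E.
have ag : analytic_at (fun s => 1 - w * cpow alpha (- s)) q.
  by exists 1; do 2 eexists; split; [exact: ltr01|exact: E].
have [g0|g0] := eqVneq (1 - w * cpow alpha (- q)) 0; last first.
  by apply: analytic_polar_le; exact: analyticV.
have [h [ah gE hq]] := expands_factor ltr01 E g0.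
have h0 : h q != 0.
  have w0 : - w != 0.
    rewrite oppr_eq0; apply: contraPneq g0 => ->.
    by rewrite mul0r subr0 => /eqP; rewrite oner_eq0.
  have l0 : - (ln alpha)%:C != 0 :> C.
    by rewrite -normc_gt0 normc_opp normc_real normr_gt0 gt_eqF ?ln_gt0.
  rewrite hq /= add0r expr1 divr1; apply: (mulf_neq0 w0).
  exact: mulf_neq0 (cpow_neq0 _ _) l0.
exists (fun s => (h s)^-1); first exact: analyticV.
by exists 1 => // s _; rewrite gE invfM expr1 mulrC.
Qed.

(** Expand [(1 + e m) ^ (- s)] by the binomial series up to an order [K]
    depending on [p].  Each [e m ^ k] is a power sum, so the main terms are
    finitely many geometric series in [m], with simple poles only, and the
    remainders form a series that is analytic as far left as [p]. *)
Lemma power_form_simple_poles z (c alpha : R) (e : nat -> R) l p :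
  1 <= c -> 1 < alpha -> all (fun x : C * C => normc x.2 < 1) l ->
  (forall m, (e m)%:C = power_sum l m) -> (forall m, `|e m| <= 2^-1) ->
  exists E : C -> C,
    (forall q, complex.Re p <= complex.Re q -> polar 1 E q) /\
    (forall s, normc z * expR (- complex.Re s * ln alpha) < 1 ->
       complex.Re p <= complex.Re s ->
       sums_to (fun m => z ^+ m * cpow (c * alpha ^+ m * (1 + e m)) (- s)) (E s)).
Proof.
move=> c1 a1 l1 el e2.
have c0 : 0 < c by apply: lt_le_trans c1.
have a0 : 0 < alpha by apply: lt_trans a1.
have [D [rho [D0 r01 hD]]] := power_sum_bound l1.
have /andP[r0 r1] := r01.
(* on a disc of radius 1 the main terms may grow like [X ^ m]; the factor
   [|e m| ^ K] makes up for it when [X * rho ^ K < 1] *)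
pose X := normc z * expR ((1 - complex.Re p) * ln alpha).
have [K hK] := geometric_small X r01.
have /choice[lk hlk] : forall k, exists l', all (fun x : C * C => normc x.2 <= 1) l' /\
    forall m, power_sum l m ^+ k = power_sum l' m.
  by move=> k; have [l' h1 h2] := power_sum_exp k l1; exists l'.
pose f m s := z ^+ m * (cpow (c * alpha ^+ m) (- s) * binom_remainder K (e m) s).
have b1 m : 1 <= c * alpha ^+ m by rewrite mulr_ege1// exprn_ege1// ltW.
have b0 m : 0 < c * alpha ^+ m by apply: lt_le_trans (b1 m).
have X0 : 0 <= X by rewrite mulr_ge0 ?normc_ge0 ?expR_ge0.
have Q01 : 0 <= X * rho ^+ K < 1 by rewrite hK mulr_ge0 ?exprn_ge0 ?(ltW r0).
have half01 : 0 < (2^-1 : R) < 1 by rewrite invr_gt0 ltr0n invf_lt1// ltr1n.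
have dom q : complex.Re p <= complex.Re q -> forall m,
    normc (z ^+ m) * expR ((1 - complex.Re q) * ln (c * alpha ^+ m)) * `|e m| ^+ K
    <= (expR ((1 - complex.Re p) * ln c) * D ^+ K) * (X * rho ^+ K) ^+ m.
  move=> pq m.
  apply: (@le_trans _ _ (normc (z ^+ m) *
     expR ((1 - complex.Re p) * ln (c * alpha ^+ m)) * (D * rho ^+ m) ^+ K)).
    apply: ler_pM; rewrite ?mulr_ge0 ?normc_ge0 ?expR_ge0 ?exprn_ge0//.
      rewrite ler_wpM2l ?normc_ge0// ler_expR ler_wpM2r ?ln_ge0//.
      by rewrite lerD2l lerN2.
    by rewrite lerXn2r ?nnegrE ?mulr_ge0 ?exprn_ge0 ?(ltW r0)// -normc_real el.
  rewrite lnM ?posrE ?exprn_gt0// lnXn// mulrDr expRD normcX.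
  have -> : (1 - complex.Re p) * (ln alpha *+ m) = ((1 - complex.Re p) * ln alpha) *+ m.
    by rewrite mulrnAr.
  rewrite -mulr_natr expRM_natr !exprMn -!exprM [(m * K)%N]mulnC.
  by rewrite le_eqVlt; apply/orP; left; apply/eqP; ring.
have AS q : complex.Re p <= complex.Re q ->
    analytic_at (fun s => sum_of (f ^~ s)) q /\ sums_to (f ^~ q) (sum_of (f ^~ q)).
  move=> pq; have [A1 A2] := @analytic_remainder_series R (GRing.exp z)
    (fun m => c * alpha ^+ m) e q 1 2^-1 K _ _ ltr01 half01 Q01 b1 e2 (dom q pq).
  by split; [exact: A1|apply: A2; rewrite subrr normc0 ltr01].
pose T (k : 'I_K) (x : C * C) s := cbinom (- s) k * (x.1 * cpow c (- s)) *
   (1 - (z * x.2) * cpow alpha (- s))^-1.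
exists (fun s => \sum_(k < K) \sum_(x <- lk k) T k x s + sum_of (f ^~ s)); split.
  move=> q pq; apply: polarD.
    apply: polar_sum => k; apply: polar_sum => x.
    apply: polarM; last exact: geometric_polar.
    apply: analyticM; first exact: analytic_cbinomN.
    by apply: analyticZ; exact: analytic_cpow.
  by apply: analytic_polar_le; have [] := AS q pq.
move=> s sL ps.
have [_ S2] := AS s ps.
have S1 : sums_to (fun m => \sum_(k < K) \sum_(x <- lk k)
    cbinom (- s) k * (x.1 * cpow c (- s)) * ((z * x.2) * cpow alpha (- s)) ^+ m)
    (\sum_(k < K) \sum_(x <- lk k) T k x s).
  apply: sums_to_sum => k _; apply: sums_to_sum => x xk.
  apply: sums_toZ; apply: sums_to_geometric.
  have x1 : normc x.2 <= 1 by have [/allP h _] := hlk k; exact: (h _ xk).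
  rewrite normcM normc_cpow (normcM z); apply: le_lt_trans sL.
  have -> : complex.Re (- s) = - complex.Re s by case: (s).
  rewrite ler_wpM2r ?expR_ge0//.
  by rewrite -[leRHS]mulr1 ler_wpM2l ?normc_ge0.
apply: (sums_to_ext _ (sums_toD S1 S2)) => m /=.
have e1 : 0 < 1 + e m.
  by have := e2 m; rewrite ler_norml => /andP[+ _]; have /andP[_] := half01; lra.
have E1 : cpow (1 + e m) (- s) =
    binom_remainder K (e m) s + \sum_(k < K) cbinom (- s) k * (e m)%:C ^+ k.
  by rewrite /binom_remainder subrK.
rewrite [cpow (_ * (1 + _)) _]cpowM// E1 /f {E1}.
move: (binom_remainder K (e m) s) => br.
rewrite 2![in RHS]mulrDr [RHS]addrC; congr (_ + _).
rewrite !mulr_sumr; apply: eq_bigr => k _; have [_ hk] := hlk k.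
rewrite el hk /power_sum !mulr_sumr; apply: eq_bigr => x _.
by rewrite cpowM ?exprn_gt0// cpow_exp// !exprMn; ring.
Qed.

End SimplePoles.

(** * The Lerch-type zeta function *)

Section Lerch.
Variable R : realType.
Local Notation C := R[i].
Implicit Types (p q s z w : C) (k m n j : nat).

Lemma half_plane_geometric z (alpha sigma : R) : z != 0 -> 1 < alpha ->
  (normc z * expR (- sigma * ln alpha) < 1) = (ln (normc z) / ln alpha < sigma).
Proof.
move=> z0 a1; have zn : 0 < normc z by rewrite normc_gt0.
rewrite -{1}[normc z]lnK ?posrE// -expRD expR_lt1 ltr_pdivrMr ?ln_gt0//.
by rewrite mulNr subr_lt0.
Qed.

(** Comparing logarithms bounds all real powers of [u m], of positive or
    negative exponent, by those of [alpha ^ m]. *)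
Lemma log_growth (u : nat -> R) (c alpha D rho : R) (e : nat -> R) :
  0 < c -> 0 < alpha -> 0 < rho < 1 -> 0 <= D ->
  (forall m, u m = c * alpha ^+ m * (1 + e m)) ->
  (forall m, `|e m| <= D * rho ^+ m) ->
  exists B, forall m, `|ln (u m) - ln alpha *+ m| <= B.
Proof.
move=> c0 a0 r01 D0 uE eD; have /andP[r0 r1] := r01.
have [N hN] := geometric_small (2 * D) r01.
pose S := \sum_(i < N) `|ln (u i) - ln alpha *+ i|.
have S0 : 0 <= S by apply: sumr_ge0.
exists (S + (`|ln c| + ln 2)) => m.
have ln2 : 0 <= ln 2 :> R by rewrite ln_ge0// ler1n.
have [mN|Nm] := ltnP m N.
  rewrite /S (bigD1 (Ordinal mN))//= -addrA lerDl !addr_ge0//.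
  by apply: sumr_ge0.
have em : `|e m| <= 2^-1.
  apply: le_trans (eD m) _; apply: (@le_trans _ _ (D * rho ^+ N)).
    by rewrite ler_wpM2l// ler_wiXn2l ?(ltW r0) ?(ltW r1).
  by rewrite -[2^-1]mulr1 ler_pdivlMl// mulrA ltW.
have /andP[e1 e2] : - 2^-1 <= e m <= 2^-1 by rewrite -ler_norml.
have h2 : (2^-1 : R) + 2^-1 = 1 by field.
have h20 : 0 < (2^-1 : R) by rewrite invr_gt0.
have e0 : 0 < 1 + e m by lra.
rewrite uE !lnM ?posrE ?mulr_gt0 ?exprn_gt0// lnXn// addrAC addrK.
rewrite ler_wpDl//; apply: le_trans (ler_normD _ _) _; rewrite lerD2l.
rewrite ler_norml; apply/andP; split.
  by rewrite -lnV ?posrE// ler_ln ?posrE//; lra.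
by rewrite ler_ln ?posrE//; lra.
Qed.

Lemma exp_log_growth (v alpha B eta : R) m :
  `|ln v - ln alpha *+ m| <= B ->
  expR (eta * ln v) <= expR (`|eta| * B) * expR (eta * ln alpha) ^+ m.
Proof.
move=> h; rewrite -expRM_natr -expRD ler_expR -lerBlDr.
rewrite mulr_natr -mulrnAr -mulrBr (le_trans (ler_norm _))//.
by rewrite normrM ler_wpM2l.
Qed.

Lemma lerch_polar (a : nat -> int) (alpha : R) z (x : R) (F : C -> C) p :
  lerch_continuation a alpha z x F -> exists N, polar N F p.
Proof. by move=> [mF _]; have [c hc] := mF p; exact: laurent_polar hc. Qed.

(** The first terms of the Dirichlet series are entire.  Once [N] of them are
    removed, [|e m| <= 1/2] and [c * alpha ^ N >= 1], and
    [power_form_simple_poles] continues the rest; [F] agrees with this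
    continuation by analytic continuation along a horizontal ray. *)
Theorem lerch_simple_poles (a : nat -> int) (alpha c : R) (e : nat -> R) l z F p :
  (forall n, (1 <= n)%N -> 0 < a n) -> 1 < alpha -> z != 0 -> 0 < c ->
  all (fun x : C * C => normc x.2 < 1) l ->
  (forall m, (e m)%:C = power_sum l m) ->
  (forall m, (a m.+1)%:~R = c * alpha ^+ m * (1 + e m)) ->
  lerch_continuation a alpha z 0 F -> polar 1 F p.
Proof.
move=> apos a1 z0 c0 l1 el aE lF.
have a0 : 0 < alpha by apply: lt_trans a1.
have [D [rho [D0 r01 hD]]] := power_sum_bound l1.
have /andP[r0 r1] := r01.
have [N1 hN1] := geometric_small (2 * D) r01.
have ia : 0 < alpha^-1 < 1 by rewrite invr_gt0 a0 invf_lt1.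
have [N2 hN2] := geometric_small c^-1 ia.
pose N := (N1 + N2)%N.
have cN : 1 <= c * alpha ^+ N.
  rewrite exprVn -invfM invf_lt1 ?mulr_gt0 ?exprn_gt0// in hN2.
  apply: le_trans (ltW hN2) _; rewrite ler_pM2l// exprD.
  by rewrite ler_peMl ?exprn_ge0 ?(ltW a0)// exprn_ege1// ltW.
have [l' l'1 hl'] := power_sum_shift N l1.
have eN m : `|e (N + m)%N| <= 2^-1.
  rewrite -normc_real el; apply: le_trans (hD _) _.
  apply: (@le_trans _ _ (D * rho ^+ N1)).
    rewrite ler_wpM2l// ler_wiXn2l ?(ltW r0) ?(ltW r1)//.
    by rewrite /N -addnA leq_addr.
  by rewrite -[2^-1]mulr1 ler_pdivlMl// mulrA ltW.
have eE m : (e (N + m)%N)%:C = power_sum l' m by rewrite el hl'.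
have [E [E1 E2]] := power_form_simple_poles z p cN a1 l'1 eE eN.
have apR n : 0 < (a n.+1)%:~R :> R by rewrite ltr0z apos.
pose G s := \sum_(n < N) z ^+ n.+1 * cpow ((a n.+1)%:~R) (- s) + z ^+ N.+1 * E s.
have Gpol q : complex.Re p <= complex.Re q -> polar 1 G q.
  move=> pq; apply: polarD.
    apply: analytic_polar_le; apply: analytic_sum => n.
    by apply: analyticZ; exact: analytic_cpow.
  by apply: polarM; [exact: analytic_cst|exact: E1].
apply: polar_near (Gpol p (lexx _)).
pose L := Num.max (ln (normc z) / ln alpha) (complex.Re p).
have : punctured p (fun s => F s - G s = 0).
  apply: (@identity_on_ray R (fun s => F s - G s) p L) => [sigma ps|s].
    have [M hM] := lerch_polar (sigma +i* complex.Im p) lF.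
    exists (maxn M 1); apply: polarB; first exact: polar_le (leq_maxl _ _) hM.
    by apply: polar_le (leq_maxr _ _) (Gpol _ _).
  rewrite /L gt_max => /andP[sL ps]; apply/eqP; rewrite subr_eq0; apply/eqP.
  have [_ /(_ s sL) sF] := lF; apply: (sums_to_unique sF).
  rewrite /G addrC.
  have sG : sums_to (fun n => z ^+ (N + n).+1 *
      cpow ((a (N + n).+1)%:~R + 0) (- s)) (z ^+ N.+1 * E s).
    have sE : normc z * expR (- complex.Re s * ln alpha) < 1.
      by rewrite half_plane_geometric.
    apply: (sums_to_ext _ (sums_toZ (a := z ^+ N.+1) (E2 s sE (ltW ps)))) => n.
    have -> : (a (N + n).+1)%:~R + 0 = c * alpha ^+ N * alpha ^+ n * (1 + e (N + n)%N).
      by rewrite addr0 aE exprD !mulrA.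
    by rewrite [LHS]mulrA -exprD addSn.
  have := iffLR (sums_to_shift (fun n => z ^+ n.+1 *
     cpow ((a n.+1)%:~R + 0) (- s)) _ N) sG.
  by under eq_bigr do rewrite addr0; exact.
by apply: puncturedS => s /eqP; rewrite subr_eq0 => /eqP.
Qed.

Lemma punctured_forall p (P : nat -> C -> Prop) K :
  (forall j, punctured p (P j)) ->
  punctured p (fun s => forall j : 'I_K, P j s).
Proof.
move=> hP; elim: K => [|K IH].
  by exists 1 => // s _ [].
apply: puncturedS2 IH (hP K) => s _ h1 h2 j.
have [jK|Kj] := ltnP j K; first exact: (h1 (Ordinal jK)).
by have -> : (j : nat) = K by apply/eqP; rewrite eqn_leq Kj -ltnS ltn_ord.
Qed.

Lemma cpow_shift (t : R) s j : 0 < t ->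
  cpow t (- s) = cpow t (- (s + j%:R)) * t%:C ^+ j.
Proof. by move=> t0; rewrite -cpow_nat// -cpowD opprD subrK. Qed.

(** Expanding [(a_n + x) ^ (- s) = a_n ^ (- s) * (1 + x / a_n) ^ (- s)] by the
    binomial series up to order [K] gives
    [phi(s, x) = sum_(j < K) binom(-s, j) x ^ j phi(s + j, 0) + H(s)], where
    [H] is analytic for [Re s > log |z| / log alpha - K], hence at [s0].  The
    poles of [phi(s + j, 0)] are simple, so that only the value at [s0] of
    their analytic factors enters the residue. *)
Theorem residue_binomial_expansion (a : nat -> int) (alpha c : R) (e : nat -> R)
    l z (phi : C -> R -> C) (x : R) s0 K :
  (forall n, (1 <= n)%N -> 0 < a n) -> 1 < alpha -> z != 0 -> 0 < c ->
  all (fun x : C * C => normc x.2 < 1) l ->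
  (forall m, (e m)%:C = power_sum l m) ->
  (forall m, (a m.+1)%:~R = c * alpha ^+ m * (1 + e m)) ->
  (forall y : R, 0 <= y < 1 ->
     lerch_continuation a alpha z y (fun s => phi s y)) ->
  0 <= x < 1 ->
  ln (normc z) / ln alpha < complex.Re s0 + K%:R ->
  residue (fun s => phi s x) s0 =
    \sum_(j < K) cbinom (- s0) j * residue (fun s => phi (s + j%:R) 0) s0 * x%:C ^+ j.
Proof.
move=> apos a1 z0 c0 l1 el aE lphi x01 hK; have /andP[x0 x1] := x01.
have a0 : 0 < alpha by apply: lt_trans a1.
have l0 : lerch_continuation a alpha z 0 (fun s => phi s 0).
  by apply: lphi; rewrite lexx ltr01.
have P0 p : polar 1 (fun s => phi s 0) p.
  exact: lerch_simple_poles apos a1 z0 c0 l1 el aE l0.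
have apR n : 1 <= (a n.+1)%:~R :> R by rewrite ler1z -gtz0_ge1 apos.
have apR0 n : 0 < (a n.+1)%:~R :> R by exact: lt_le_trans (apR n).
have [D [rho [D0 r01 hD]]] := power_sum_bound l1.
have eD m : `|e m| <= D * rho ^+ m by rewrite -normc_real el.
have [B hB] := log_growth c0 a0 r01 D0 aE eD.
pose L := ln (normc z) / ln alpha.
(* half the distance from [s0] to the line [Re s = L - K] *)
pose r := (complex.Re s0 + K%:R - L) / 2.
have r0 : 0 < r by rewrite divr_gt0// subr_gt0.
(* a positive bound for [x / a_n], also when [x = 0]; it uses [a_n >= 1] *)
pose t := Num.max x 2^-1.
have t01 : 0 < t < 1.
  by rewrite lt_max invr_gt0 ltr0n orbT gt_max x1 invf_lt1// ltr1n.
pose ee n : R := x / (a n.+1)%:~R.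
have ee0 n : 0 <= ee n by rewrite divr_ge0// ltW.
have eet n : `|ee n| <= t.
  rewrite ger0_norm// le_max; apply/orP; left.
  by rewrite ler_pdivrMr// ler_peMr.
pose f n s := z ^+ n.+1 * (cpow ((a n.+1)%:~R) (- s) * binom_remainder K (ee n) s).
(* on the disc of radius [r] around [q] the [n]-th remainder is of size
   [|z| ^ n * a_n ^ eta] at most, as [Re q >= Re s0] *)
pose eta := r - complex.Re s0 - K%:R.
have Q01 : 0 <= normc z * expR (eta * ln alpha) < 1.
  rewrite mulr_ge0 ?normc_ge0 ?expR_ge0//= -[eta]opprK half_plane_geometric//.
  have -> : - eta = L + r by rewrite /eta /r; field.
  by rewrite ltrDl.
have dom q : complex.Re s0 <= complex.Re q -> forall n,
    normc (z ^+ n.+1) * expR ((r - complex.Re q) * ln ((a n.+1)%:~R)) * `|ee n| ^+ K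
    <= (normc z * expR (`|eta| * B)) * (normc z * expR (eta * ln alpha)) ^+ n.
  move=> sq n.
  have la : 0 <= ln ((a n.+1)%:~R) :> R by rewrite ln_ge0.
  have h1 : `|ee n| ^+ K <= expR (- K%:R * ln ((a n.+1)%:~R)).
    rewrite mulNr expRN mulrC expRM_natr lnK ?posrE// ger0_norm// -exprVn.
    rewrite lerXn2r ?nnegrE ?invr_ge0 ?(ltW (apR0 n))//.
    by rewrite ler_piMl ?invr_ge0 ?ltW.
  rewrite -mulrA; apply: (@le_trans _ _ (normc (z ^+ n.+1) *
     expR (eta * ln ((a n.+1)%:~R)))).
    rewrite ler_wpM2l ?normc_ge0//.
    apply: le_trans (ler_wpM2l (expR_ge0 _) h1) _.
    rewrite -expRD ler_expR -mulrDl ler_wpM2r// /eta; lra.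
  rewrite normcX exprS exprMn.
  apply: le_trans (ler_wpM2l _ (exp_log_growth eta (hB n))) _.
    by rewrite mulr_ge0 ?exprn_ge0 ?normc_ge0.
  by rewrite le_eqVlt; apply/orP; left; apply/eqP; ring.
have AS q : complex.Re s0 <= complex.Re q ->
    analytic_at (fun s => sum_of (f ^~ s)) q /\ sums_to (f ^~ q) (sum_of (f ^~ q)).
  move=> pq; have [A1 A2] := @analytic_remainder_series R (fun n => z ^+ n.+1)
    (fun n => (a n.+1)%:~R) ee q r t K _ _ r0 t01 Q01 apR eet (dom q pq).
  by split; [exact: A1|apply: A2; rewrite subrr normc0].
pose T (j : 'I_K) s := cbinom (- s) j * x%:C ^+ j * phi (s + j%:R) 0.
pose G s := \sum_(j < K) T j s + sum_of (f ^~ s).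
have Gpol q : complex.Re s0 <= complex.Re q -> polar 1 G q.
  move=> sq; apply: polarD.
    apply: polar_sum => j; apply: polarM.
      by apply: analyticM; [exact: analytic_cbinomN|exact: analytic_cst].
    exact: (polar_shift (G := fun s => phi s 0)).
  by apply: analytic_polar_le; have [] := AS q sq.
have eqG : punctured s0 (fun s => phi s x = G s).
  have : punctured s0 (fun s => phi s x - G s = 0).
    apply: (@identity_on_ray R (fun s => phi s x - G s) s0
       (Num.max L (complex.Re s0))) => [sigma ps|s].
      have [M hM] := lerch_polar (sigma +i* complex.Im s0) (lphi x x01).
      exists (maxn M 1); apply: polarB; first exact: polar_le (leq_maxl _ _) hM.
      by apply: polar_le (leq_maxr _ _) (Gpol _ _).
    rewrite gt_max => /andP[sL ps]; apply/eqP; rewrite subr_eq0; apply/eqP.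
    have [_ /(_ s sL) sF] := lphi x x01; apply: (sums_to_unique sF).
    have S1 : sums_to (fun n => \sum_(j < K) cbinom (- s) j * x%:C ^+ j *
        (z ^+ n.+1 * cpow ((a n.+1)%:~R + 0) (- (s + j%:R)))) (\sum_(j < K) T j s).
      apply: sums_to_sum => j _; apply: sums_toZ.
      have [_ h] := l0; apply: h; apply: lt_le_trans sL _.
      have -> : complex.Re (s + j%:R) = complex.Re s + j%:R.
        have -> : (j%:R : C) = (j%:R : R)%:C by rewrite rmorph_nat.
        by case: (s).
      by rewrite lerDl.
    have [_ S2] := AS s (ltW ps).
    apply: (sums_to_ext _ (sums_toD S1 S2)) => n /=.
    have ax : (a n.+1)%:~R + x = (a n.+1)%:~R * (1 + ee n).
      by rewrite /ee; field; rewrite gt_eqF.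
    have e1 : 0 < 1 + ee n by rewrite ltr_wpDr.
    have E1 : cpow (1 + ee n) (- s) = binom_remainder K (ee n) s +
        \sum_(j < K) cbinom (- s) j * (ee n)%:C ^+ j.
      by rewrite /binom_remainder subrK.
    rewrite ax cpowM// E1 /f {E1}.
    move: (binom_remainder K (ee n) s) => br.
    rewrite 2![in RHS]mulrDr [RHS]addrC; congr (_ + _).
    rewrite !mulr_sumr; apply: eq_bigr => j _.
    rewrite addr0 [cpow _ (- s)](cpow_shift s j (apR0 n)) /ee rmorphM fmorphV exprMn.
    have ac : ((a n.+1)%:~R : R)%:C ^+ j != 0.
      by rewrite expf_neq0// -normc_gt0 normc_real normr_gt0 gt_eqF.
    move: ac (cpow _ _); rewrite exprVn; move: (_%:C ^+ j) => A A0 Y.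
    by field.
  by apply: puncturedS => s /eqP; rewrite subr_eq0 => /eqP.
have /choice[g hg] : forall j, exists g, analytic_at g s0 /\
    punctured s0 (fun s => phi (s + j%:R) 0 = g s / (s - s0)).
  move=> j; have [g ag hg] := polar_shift (G := fun s => phi s 0) (P0 (s0 + j%:R)).
  by exists g; split=> //; apply: puncturedS hg => s ->; rewrite expr1.
have gres j : residue (fun s => phi (s + j%:R) 0) s0 = g j s0.
  by have [ag hgj] := hg j; exact: residue_simple.
have [H1 _] := AS s0 (lexx _).
rewrite (@residue_simple _ _ (fun s => \sum_(j < K) cbinom (- s) j * x%:C ^+ j * g j s
    + (s - s0) * sum_of (f ^~ s))).
- rewrite subrr mul0r addr0; apply: eq_bigr => j _.
  by rewrite gres mulrAC.
- apply: analyticD.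
    apply: analytic_sum => j; apply: analyticM; last by have [] := hg j.
    by apply: analyticM; [exact: analytic_cbinomN|exact: analytic_cst].
  apply: analyticM H1.
  by apply: analyticB; [exact: analytic_id|exact: analytic_cst].
have gall := punctured_forall K (fun j => proj2 (hg j)).
apply: puncturedS2 eqG gall => s ss0 -> gs.
rewrite /G mulrDl [(s - s0) * _]mulrC mulfK ?subr_eq0//; congr (_ + _).
by rewrite mulr_suml; apply: eq_bigr => j _; rewrite /T gs mulrA.
Qed.

End Lerch.

(** * The residue formula *)

(** The number of natural numbers [j] with [j <= i]. *)
Definition nonneg_count (i : int) : nat := if i is Posz n then n.+1 else 0%N.

Lemma sum_upto_int (V : nmodType) (i : int) (f : nat -> V) :
  \sum_(0 <= j < `|i|%N.+1 | j%:Z <= i) f j = \sum_(j < nonneg_count i) f j.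
Proof.
case: i => n /=; last by rewrite big_ord0 big_pred0.
rewrite -(big_mkord xpredT f) big_nat_cond [RHS]big_nat_cond.
by apply: eq_bigl => j; rewrite andbT ltnS lez_nat leq0n andbb.
Qed.

Lemma lt_nonneg_count (i : int) : i < (nonneg_count i)%:Z.
Proof. by case: i => n //=; rewrite ltz_nat. Qed.

Theorem proposition5p5 (R : realType) (a : nat -> int) (P : {poly int})
    (alpha1 : R)
    (a_rec : linear_recurrence a)
    (P_min : minimal_polynomial a P)
    (P_irr : irreducible_poly (map_poly intr P : {poly rat}))
    (alpha1_dom : dominant_root P alpha1)
    (a_pos : forall n : nat, (1 <= n)%N -> 0 < a n)
    (a_incr : forall n : nat, (1 <= n)%N -> a n < a n.+1)
    (z : R[i]) (z_neq0 : z != 0)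
    (phi : R[i] -> R -> R[i])
    (phi_cont : forall x : R, 0 <= x < 1 ->
       lerch_continuation a alpha1 z x (fun s => phi s x))
    (x : R) (x01 : 0 <= x < 1)
    (s0 : R[i]) (s0_pole : is_pole (fun s => phi s x) s0) :
  let j0 : int := Num.floor (- complex.Re s0 + ln (normc z) / ln alpha1) in
  (exists p : {poly R[i]}, forall y : R, 0 <= y < 1 ->
     residue (fun s => phi s y) s0 = p.[y%:C]) /\
  residue (fun s => phi s x) s0 =
    \sum_(0 <= j < `|j0|%N.+1 | j%:Z <= j0)
      cbinom (- s0) j * residue (fun s => phi (s + j%:R) 0) s0 * x%:C ^+ j.
Proof.
move=> j0; have [Pm Pa _] := P_min; have [_ alpha1_gt1 _] := alpha1_dom.
have [c [e [l [c0 l1 el aE]]]] := dominant_form Pm Pa P_irr alpha1_dom a_pos.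
pose K := nonneg_count j0.
have hK : ln (normc z) / ln alpha1 < complex.Re s0 + K%:R.
  rewrite -ltrBlDl [X in X < _]addrC pmulrn -floor_lt_int.
  exact: lt_nonneg_count.
have res y : 0 <= y < 1 -> _ := fun y01 =>
  residue_binomial_expansion a_pos alpha1_gt1 z_neq0 c0 l1 el aE phi_cont y01 hK.
split; last by rewrite sum_upto_int res.
exists (\sum_(j < K) (cbinom (- s0) j *
  residue (fun s => phi (s + j%:R) 0) s0) *: 'X^j) => y y01.
rewrite res// horner_sum; apply: eq_bigr => j _.
by rewrite hornerZ hornerXn.
Qed.
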